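(* Let $Q$ be a convex polygon and $r>\varepsilon>0$ such that $\mathrm{offset}(\Pi,r)$ is $\varepsilon$-close to $Q$, where $\Pi:=\mathrm{inset}(\mathrm{offset}(Q,\varepsilon),r)$. Let $P$ be a minimal polygonal region for $Q$, having $\mathrm{OPT}$ vertices. Then, for any $s\in\partial\Pi$, the polygonal region $P^s$ has at most $\mathrm{OPT}+1$ vertices.
   Context: A polygonal region is a (closed) set whose boundary consists of finitely many line segments with disjoint interiors, whose endpoints are its vertices. $D_s(c)$ is the closed disk of radius $s$ around $c$, $\mathrm{offset}(X,s):=X\oplus D_s(0)$, $\mathrm{inset}(X,s):=\{x\mid D_s(x)\subseteq X\}$. Closed sets are $\varepsilon$-close if their symmetric Hausdorff distance is at most $\varepsilon$. For convex $Q$ and $r>\varepsilon$, $\Pi$ is a convex polygon. A polygonal region $P$ is (vertex-)minimal if $\mathrm{offset}(P,r)$ is $\varepsilon$-close to $Q$ and no other such region has fewer vertices. Let $q_1,\ldots,q_n$ be the vertices of $Q$ in counterclockwise order, $K_i:=D_{r+\varepsilon}(q_i)$, and let the eyelets be $\kappa_i:=K_i\cap\Pi$. For $u,u'\in\partial\Pi$, $[u,u']\subset\partial\Pi$ is the set of points met when travelling along $\partial\Pi$ from $u$ to $u'$ counterclockwise; $(u,u')$, $(u,u']$, $[u,u')$ are the corresponding (half-)open versions. The portion of $\kappa_i\cap\partial\Pi$ visible from $q_i$ (with $\Pi$ as an obstacle) is an interval $[v_i,w_i]$; $v_i$ is called the spot of $\kappa_i$. For $u,u'\in\partial\Pi$,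 the segment $\overline{uu'}$ is good if for all spots $v_i\in(u,u')$, $\overline{uu'}$ intersects the eyelet $\kappa_i$. The horizon $h_u\in\partial\Pi$ of $u\in\partial\Pi$ is the maximal point in counterclockwise direction such that $\overline{u h_u}$ is good. For $s\in\partial\Pi$, the polygonal region $P^s$ is given by its vertices, defined iteratively: $p_1:=s$; for $j\ge1$, if the segment $\overline{p_j s}$ (which would close $P^s$) is good, stop; otherwise set $p_{j+1}:=h_{p_j}$. *)

(* Defs.v *)
From HB Require Import structures.
From mathcomp Require Import all_boot all_order all_algebra.
From mathcomp Require Import all_classical all_reals all_analysis.

Set Implicit Arguments.
Unset Strict Implicit.
Unset Printing Implicit Defensive.

Import Order.TTheory GRing.Theory Num.Theory.
Import numFieldNormedType.Exports.

Local Open Scope classical_set_scope.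
Local Open Scope ring_scope.

Notation plane R := 'rV[R]_2.

Section Plane.
Context {R : realType}.
Implicit Types (a b c d q s u v w x y : plane R) (X Y : set (plane R)).

(* The library norm on 'rV[R]_2 is the sup norm; it is only used through the
   topology (closed, closure, interior), which does not depend on the norm. *)
Definition enorm x : R := Num.sqrt (x 0 0 ^+ 2 + x 0 1 ^+ 2).

Definition disk (rho : R) c : set (plane R) := [set x | enorm (x - c) <= rho].

Definition offset X (rho : R) : set (plane R) :=
  [set x + d | x in X & d in disk rho 0].

Definition inset X (rho : R) : set (plane R) := [set x | disk rho x `<=` X].

Definition boundary X : set (plane R) := closure X `\` interior X.

Definition dist_to x Y : \bar R := ereal_inf [set (enorm (x - y))%:E | y in Y].

Definition hausdorff X Y : \bar R :=
  Order.max (ereal_sup [set dist_to x Y | x in X])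
            (ereal_sup [set dist_to y X | y in Y]).

Definition eps_close (eps : R) X Y : Prop := (hausdorff X Y <= eps%:E)%E.

Definition seg a b : set (plane R) :=
  [set (1 - t) *: a + t *: b | t in `[0, 1]].

Definition open_seg a b : set (plane R) :=
  [set (1 - t) *: a + t *: b | t in `]0, 1[].

(* Holes, several components, dangling segments and isolated points (as sides
   with equal endpoints) are all allowed. *)
Record polygonal_region := PolygonalRegion {
  region :> set (plane R) ;
  sides : seq (plane R * plane R) ;
  region_closed : closed region ;
  region_boundary :
    boundary region = \bigcup_(e in [set` sides]) seg e.1 e.2 ;
  sides_disjoint :
    trivIset `I_(size sides)
      (fun i => open_seg (nth (0, 0) sides i).1 (nth (0, 0) sides i).2) }.

Definition vertices (P : polygonal_region) : seq (plane R) :=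
  undup ([seq e.1 | e <- sides P] ++ [seq e.2 | e <- sides P]).

Definition minimal_region (Q : set (plane R)) (r eps : R)
    (P : polygonal_region) : Prop :=
  eps_close eps (offset P r) Q /\
  forall P' : polygonal_region, eps_close eps (offset P' r) Q ->
    (size (vertices P) <= size (vertices P'))%N.

(* Twice the signed area of the triangle a b c. *)
Definition orient a b c : R :=
  (b 0 0 - a 0 0) * (c 0 1 - a 0 1) - (b 0 1 - a 0 1) * (c 0 0 - a 0 0).

Definition convex_hull X : set (plane R) :=
  smallest (@convex_set R (plane R)) X.

(* Q is the convex polygon whose vertices, in counterclockwise order, are qs. *)
Definition convex_polygon (Q : set (plane R)) (qs : seq (plane R)) : Prop :=
  [/\ (3 <= size qs)%N,
      forall i j k : nat, (i < j)%N -> (j < k)%N -> (k < size qs)%N ->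
        0 < orient (nth 0 qs i) (nth 0 qs j) (nth 0 qs k)
    & Q = convex_hull [set` qs]].

(* x lies on the ray from c in direction (cos t, sin t). *)
Definition at_angle c (t : R) x : Prop :=
  exists2 rho : R, 0 < rho &
    x = c + rho *: \row_(j < 2) (if j == 0 then cos t else sin t).

(* Travelling counterclockwise along the boundary of a convex region K means
   that the polar angle about an interior point c increases; the choice of c is
   irrelevant. The journey from u to u' starts at angle alpha and ends at angle
   beta, after at most one turn. As alpha < beta, the journey from u to u
   itself is one full turn. The arcs are empty when K has empty interior. *)
Definition journey (K : set (plane R)) u u' c (alpha beta : R) : Prop :=
  [/\ interior K c, alpha < beta, beta <= alpha + 2 * pi,
      at_angle c alpha u & at_angle c beta u'].

(* [u, u'], (u, u') and (u, u'] *)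
Definition arc_cc (K : set (plane R)) u u' : set (plane R) :=
  [set x | boundary K x /\ exists c alpha beta t,
     [/\ journey K u u' c alpha beta, t \in `[alpha, beta] & at_angle c t x]].

Definition arc_oo (K : set (plane R)) u u' : set (plane R) :=
  [set x | boundary K x /\ exists c alpha beta t,
     [/\ journey K u u' c alpha beta, t \in `]alpha, beta[ & at_angle c t x]].

Definition arc_oc (K : set (plane R)) u u' : set (plane R) :=
  [set x | boundary K x /\ exists c alpha beta t,
     [/\ journey K u u' c alpha beta, t \in `]alpha, beta] & at_angle c t x]].

Section Horizon.
Variables (K : set (plane R)) (qs : seq (plane R)) (r eps : R).

Definition eyelet q : set (plane R) := disk (r + eps) q `&` K.

Definition visible_portion q : set (plane R) :=
  [set x | [/\ eyelet q x, boundary K x & seg q x `&` K = [set x]]].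

(* v is the first point of the interval [v, w] = visible_portion q. The case
   w = v is the one-point interval, whereas arc_cc K v v is a full turn. *)
Definition spot q v : Prop :=
  visible_portion q = [set v] \/
  exists2 w, w <> v & visible_portion q = arc_cc K v w.

Definition good u u' : Prop :=
  forall q v, q \in qs -> spot q v -> arc_oo K u u' v ->
    seg u u' `&` eyelet q !=set0.

(* h is the good endpoint met last on the journey from u around the boundary. *)
Definition horizon u h : Prop :=
  [/\ boundary K h, good u h
    & forall u', boundary K u' -> good u u' -> arc_oc K u h u'].

(* ps is the (terminated) vertex sequence p_1, ..., p_k of P^s. *)
Definition greedy_vertices s (ps : seq (plane R)) : Prop :=
  [/\ (0 < size ps)%N,
      nth 0 ps 0 = s,
      forall j : nat, (j.+1 < size ps)%N ->
        ~ good (nth 0 ps j) s /\ horizon (nth 0 ps j) (nth 0 ps j.+1)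
    & good (nth 0 ps (size ps).-1) s].

End Horizon.
End Plane.

Arguments polygonal_region R : clear implicits.

(* Main.v *)
Require Import Defs.
From HB Require Import structures.
From mathcomp Require Import all_boot all_order all_algebra.
From mathcomp Require Import all_classical all_reals all_analysis.
From mathcomp Require Import ring lra.
Import Order.TTheory GRing.Theory Num.Theory.
Import numFieldNormedType.Exports.
Local Open Scope classical_set_scope.
Local Open Scope ring_scope.

Set Implicit Arguments.
Unset Strict Implicit.
Unset Printing Implicit Defensive.

(* Visibility matters only through the fact that a spot lies in its eyelet:
   eyelets are convex, so a segment joining a spot to a point of the eyelet must
   cross every chord that separates the two.

   Suppose [p_(j+1)] is the horizon of [p_j] and [u] is slightly beyond
   [p_(j+1)]. The chord [p_j u] misses an eyelet whose spot it cuts off, so this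
   eyelet lies in the pocket between the chord and the arc, outside the hull of
   the complementary arc. Since the hull of the vertices of [P] meets the eyelet,
   some vertex of [P] lies in that pocket, and by finiteness one vertex [w_j]
   works for all [u] close to [p_(j+1)]. Seen from an interior [w_j], the arc from
   [p_j] to [p_(j+1)] therefore subtends an angle of at least [pi]; the arcs of
   the steps that precede the closing one are disjoint and leave a nontrivial rest
   of the boundary, so the [w_j] are pairwise distinct and their number is at
   most OPT. *)

(** * Polar angles *)

Section Angles.
Context {R : realType}.
Implicit Types (a b c x y : plane R) (s t u : R).

Lemma plane_eq x y : x 0 0 = y 0 0 -> x 0 1 = y 0 1 -> x = y.
Proof.
move=> h0 h1; apply/rowP => -[[|[|//]] hi].
- by rewrite (_ : Ordinal hi = 0) //; apply/val_inj.
- by rewrite (_ : Ordinal hi = 1) //; apply/val_inj.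
Qed.

(** Literally the unit row vector inside [at_angle], so that unfolded angles fold back with
    [-/(dir _)]. *)
Definition dir t : plane R := \row_(j < 2) (if j == 0 then cos t else sin t).

Lemma dirE0 t : dir t 0 0 = cos t. Proof. by rewrite mxE. Qed.

Lemma dirE1 t : dir t 0 1 = sin t. Proof. by rewrite mxE. Qed.

Lemma dirDpi t : dir (t + pi) = - dir t.
Proof. by apply: plane_eq; rewrite !mxE /= ?cosDpi ?sinDpi. Qed.

Lemma dirD2pi t : dir (t + 2 * pi) = dir t.
Proof. by rewrite mulr_natl mulr2n addrA !dirDpi opprK. Qed.

Lemma orient_dir c (p q s t : R) :
  orient c (c + p *: dir s) (c + q *: dir t) = p * q * sin (t - s).
Proof. by rewrite /orient sinB !mxE /=; ring. Qed.

Lemma cos_lt1 t : 0 < t < 2 * pi -> cos t < 1.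
Proof.
move=> /andP[t0 t2].
rewrite (_ : t = (t / 2) *+ 2); last by rewrite -mulr_natl; field.
have s0 : 0 < sin (t / 2) by apply: sin_gt0_pi; apply/andP; split; lra.
by rewrite cos_mulr2n cos2sin2; nra.
Qed.

Lemma sin_lt0_pi t : pi < t < 2 * pi -> sin t < 0.
Proof.
move=> /andP[t0 t2]; rewrite (_ : t = t - pi + pi); last by ring.
by rewrite sinDpi oppr_lt0; apply: sin_gt0_pi; apply/andP; split; lra.
Qed.

Lemma dir_inj s t : 0 < t - s < 2 * pi -> dir s <> dir t.
Proof.
move=> /cos_lt1 h E; move: h; rewrite cosB.
have E0 : cos s = cos t by rewrite -!dirE0 E.
have E1 : sin s = sin t by rewrite -!dirE1 E.
by rewrite E0 E1 -!expr2 cos2Dsin2 ltxx.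
Qed.

Lemma dir_norm (p : R) t : (p *: dir t) 0 0 ^+ 2 + (p *: dir t) 0 1 ^+ 2 = p ^+ 2.
Proof. by rewrite !mxE /= !exprMn -mulrDr cos2Dsin2 mulr1. Qed.

Lemma at_angle_inj c s t x :
  at_angle c s x -> at_angle c t x -> `|s - t| < 2 * pi -> s = t.
Proof.
move=> [p p0 ->] [q q0] /addrI E.
have pq : p = q.
  have := dir_norm p s; rewrite {1 2}/dir E dir_norm => /eqP.
  by rewrite eqrXn2 ?ltW// => /eqP.
move: E; rewrite pq => /(congr1 ( *:%R q^-1)).
rewrite !scalerA mulVf ?lt0r_neq0// !scale1r => E.
have [st|st|//] := ltgtP s t; rewrite ltr_norml => /andP[h1 h2].
- by exfalso; apply: (@dir_inj s t) => //; apply/andP; split; lra.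
- by exfalso; apply: (@dir_inj t s) => //; apply/andP; split; lra.
Qed.

Lemma at_angleD2pi c t x : at_angle c t x <-> at_angle c (t + 2 * pi) x.
Proof.
by split=> -[p p0 ->]; exists p => //; rewrite -/(dir _) -/(dir _) dirD2pi.
Qed.

Lemma at_angleDz c t x (k : int) :
  at_angle c t x -> at_angle c (t + k%:~R * (2 * pi)) x.
Proof.
move=> h; elim/int_rect: k => [|n IH|n IH]; first by rewrite mul0r addr0.
- rewrite (_ : t + _ = t + (Posz n)%:~R * (2 * pi) + 2 * pi); last first.
    by rewrite intS rmorphD /=; ring.
  exact: (at_angleD2pi _ _ _).1.
- apply: (at_angleD2pi _ _ _).2; rewrite (_ : t + _ + _ = t + (- Posz n)%:~R * (2 * pi)) //.
  by rewrite intS opprD rmorphD /=; ring.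
Qed.

Lemma at_angle_exists c x : x <> c -> exists t, at_angle c t x.
Proof.
move=> xc; have [y hx] : exists y, x = c + y by exists (x - c); rewrite addrC subrK.
pose p := enorm y.
have sq : p ^+ 2 = y 0 0 ^+ 2 + y 0 1 ^+ 2.
  by rewrite /p /enorm sqr_sqrtr// addr_ge0 ?sqr_ge0.
have p0 : 0 < p.
  rewrite lt_neqAle /p sqrtr_ge0 andbT; apply/eqP => E.
  apply: xc; rewrite hx -[RHS]addr0; congr (_ + _).
  move: sq; rewrite /p -E expr0n /= => /esym/eqP.
  rewrite paddr_eq0 ?sqr_ge0// !sqrf_eq0 => /andP[/eqP h0 /eqP h1].
  by apply: plane_eq; rewrite [RHS]mxE.
have bnd : -1 <= y 0 0 / p <= 1.
  by rewrite ler_pdivlMr// ler_pdivrMr//; apply/andP; split; nra.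
have cE := @acosK R _ bnd.
have sE := sin_acos bnd.
have n0 : p != 0 by rewrite gt_eqF.
(* The arc cosine only recovers the modulus of the second coordinate; the sign of [y 0 1] then
   decides between the angle and its opposite. *)
have sE2 : p * sin (acos (y 0 0 / p)) = `|y 0 1|.
  rewrite sE -sqrtr_sqr -[X in X * _](gtr0_norm p0) -sqrtr_sqr -sqrtrM ?sqr_ge0//.
  congr Num.sqrt; rewrite (_ : y 0 1 ^+ 2 = p ^+ 2 - y 0 0 ^+ 2); last by rewrite sq; ring.
  by field.
have [y1|y1] := leP 0 (y 0 1).
- exists (acos (y 0 0 / p)); exists p => //; rewrite hx; congr (_ + _).
  apply: plane_eq; rewrite !mxE /=; first by rewrite cE mulrC divfK.
  by rewrite sE2 ger0_norm.
- exists (- acos (y 0 0 / p)); exists p => //; rewrite hx; congr (_ + _).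
  apply: plane_eq; rewrite !mxE /=; first by rewrite cosN cE mulrC divfK.
  by rewrite sinN mulrN sE2 ltr0_norm ?opprK.
Qed.

Lemma at_angle_window c x s : x <> c ->
  exists t, [/\ s < t, t <= s + 2 * pi & at_angle c t x].
Proof.
move=> /at_angle_exists[t ht].
have pi0 : 0 < pi :> R := pi_gt0 R.
pose k := Num.floor ((s - t) / (2 * pi)).
have p0 : 0 < 2 * pi :> R by lra.
have := floor_itv ((s - t) / (2 * pi)).
rewrite -/k ler_pdivlMr// ltr_pdivrMr// => /andP[h1 h2].
(* One turn more than the floor, because the window is open on the left and closed on the right. *)
exists (t + (k + 1)%:~R * (2 * pi)); split; last exact: at_angleDz.
- by lra.
- by move: h1; rewrite rmorphD /= mulrDl; lra.
Qed.

End Angles.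

(** * Convex bodies and their boundary in polar coordinates *)

Section ConvexBody.
Context {R : realType}.
Implicit Types (c d x y z : plane R) (s t p q : R).

Lemma convex_setE (A : set (plane R)) : @convex_set R (plane R) A <->
  forall x y t, A x -> A y -> 0 <= t <= 1 -> A ((1 - t) *: x + t *: y).
Proof.
split=> [cA x y t Ax Ay /andP[t0 t1]|cA x y k].
- have h0 : 0 <= 1 - t by rewrite subr_ge0.
  have h1 : 1 - t <= 1 by rewrite gerBl.
  have := cA x y (Itv01 h0 h1); rewrite !inE => /(_ Ax Ay).
  by rewrite /conv /= /unstable.onem subKr.
- rewrite !inE => Ax Ay.
  have := cA x y (1 - k%:num) Ax Ay; rewrite subKr; apply.
  by rewrite subr_ge0 gerBl; apply/andP; split; [exact: le1|exact: ge0].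
Qed.

Lemma convex_hull_min (X A : set (plane R)) :
  @convex_set R (plane R) A -> X `<=` A -> convex_hull X `<=` A.
Proof. by move=> cA XA x hx; exact: (hx A (conj cA XA)). Qed.

Lemma convex_hull_sub (X : set (plane R)) : X `<=` convex_hull X.
Proof. by move=> x Xx A [_ XA]; exact: XA. Qed.

Lemma convex_hull_convex (X : set (plane R)) :
  @convex_set R (plane R) (convex_hull X).
Proof.
apply/convex_setE => x y t hx hy t01 A [cA XA].
move: (cA) => /convex_setE; apply => //; first exact: (hx A (conj cA XA)).
exact: (hy A (conj cA XA)).
Qed.

Lemma coord_le_norm x (i : 'I_2) : `|x 0 i| <= `|x|.
Proof.
rewrite [leRHS]/Num.norm /= mx_normrE; apply/bigmax_geP; right => /=.
by exists (0, i).
Qed.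

(** [p] is a Euclidean length and the bars denote the sup norm; the factor 2 replaces the sharp
    square root of 2. *)
Lemma radius_le_norm p t : p <= 2 * `|p *: dir t|.
Proof.
have [p0|p0] := leP p 0; first by apply: (le_trans p0); rewrite mulr_ge0.
have := dir_norm p t; set x := p *: dir t => E.
have h0 := coord_le_norm x 0; have h1 := coord_le_norm x 1.
rewrite -(@ler_pXn2r _ 2%N)// ?nnegrE ?mulr_ge0// ?(ltW p0)// -E.
rewrite -(real_normK (num_real (x 0 0))) -(real_normK (num_real (x 0 1))).
have s0 : `|x 0 0| ^+ 2 <= `|x| ^+ 2 by rewrite ler_pXn2r ?nnegrE.
have s1 : `|x 0 1| ^+ 2 <= `|x| ^+ 2 by rewrite ler_pXn2r ?nnegrE.
have := sqr_ge0 `|x|; rewrite exprMn. lra.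
Qed.

Lemma dir_continuous : continuous (@dir R).
Proof.
move=> t; rewrite (_ : dir = fun s => cos s *: dir 0 + sin s *: dir (pi / 2)).
  by apply: cvgD; apply: cvgZr_tmp; [exact: continuous_cos|exact: continuous_sin].
apply/funext => s; apply: plane_eq;
  by rewrite !mxE /= ?cos0 ?sin0 ?cos_pihalf ?sin_pihalf; ring.
Qed.

Variable K : set (plane R).
Hypotheses (cvxK : @convex_set R (plane R) K) (cptK : compact K).

Let closedK : closed K.
Proof. by apply: compact_closed => //; exact: norm_hausdorff. Qed.

Let cvx x y t : K x -> K y -> 0 <= t <= 1 -> K ((1 - t) *: x + t *: y).
Proof. by move: cvxK => /convex_setE; apply. Qed.

Lemma boundary_sub x : boundary K x -> K x.
Proof. by case; rewrite -(closure_id K).1. Qed.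

Lemma boundary_notin_interior x : boundary K x -> ~ interior K x.
Proof. by case. Qed.

Lemma interior_ball c : interior K c ->
  exists2 e, 0 < e & forall z, `|z| <= e -> K (c + z).
Proof.
move=> /nbhs_ballP[e /= e0 h]; exists (e / 2); first by rewrite divr_gt0.
move=> z ze; apply: h; rewrite -ball_normE /= opprD addNKr normrN.
by apply: (le_lt_trans ze); lra.
Qed.

(** The homothety about [y] with ratio [1 - t] carries a ball about [c] inside [K] to a ball about
    the combination. *)
Lemma interior_comb c y t : interior K c -> K y -> 0 <= t < 1 ->
  interior K ((1 - t) *: c + t *: y).
Proof.
move=> /interior_ball[e e0 h] Ky /andP[t0 t1].
apply/nbhs_ballP; exists ((1 - t) * e) => /=; first by rewrite mulr_gt0// subr_gt0.
move=> z; rewrite -ball_normE /= => ze.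
set m := (1 - t) *: c + t *: y in ze.
have t1' : 1 - t != 0 by rewrite subr_eq0 gt_eqF.
rewrite (_ : z = (1 - t) *: (c + (1 - t)^-1 *: (z - m)) + t *: y).
  apply: cvx => //; last by rewrite t0 ltW.
  apply: h; rewrite normrZ gtr0_norm ?invr_gt0 ?subr_gt0//.
  by rewrite mulrC ler_pdivrMr ?subr_gt0// mulrC distrC ltW.
rewrite scalerDr scalerA mulfV// scale1r addrAC -/m addrC subrK //.
Qed.

(** The radial function of [K] about [c]. With [bd] it parametrises the boundary of a convex body by
    the polar angle. *)
Definition rad c t := sup [set p | 0 <= p /\ K (c + p *: dir t)].

Definition bd c t := c + rad c t *: dir t.

Section Center.
Variable c : plane R.
Hypothesis intc : interior K c.

Let Kc : K c. Proof. exact: interior_subset. Qed.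

Lemma rad_bounded : exists M, forall p t, 0 <= p -> K (c + p *: dir t) -> p <= M.
Proof.
have [M [_ hM]] := compact_bounded cptK.
exists (2 * (M + 1 + `|c|)) => p t p0 /(hM (M + 1) ltac:(by rewrite ltrDl)) h.
apply: (le_trans (radius_le_norm p t)); rewrite ler_pM2l//.
rewrite -[X in `|X|](addKr c); apply: (le_trans (ler_normD _ _)).
by rewrite normrN addrC lerD2r.
Qed.

Lemma rad_has_sup t : has_sup [set p | 0 <= p /\ K (c + p *: dir t)].
Proof.
split; first by exists 0; rewrite /= scale0r addr0.
by have [M hM] := rad_bounded; exists M => p [p0 Kp]; exact: (hM p t).
Qed.

Lemma rad_ub p t : 0 <= p -> K (c + p *: dir t) -> p <= rad c t.
Proof. by move=> p0 Kp; apply: (sup_upper_bound (rad_has_sup t)). Qed.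

Lemma rad_gt0 t : 0 < rad c t.
Proof.
have [e e0 h] := interior_ball intc.
have n0 : 0 < `|dir t|.
  rewrite normr_gt0; apply/eqP => E; have := dir_norm 1 t.
  by rewrite E scaler0 !mxE expr0n expr1n /= addr0 => /esym/eqP; rewrite oner_eq0.
apply: (@lt_le_trans _ _ (e / `|dir t|)); first by rewrite divr_gt0.
apply: rad_ub; first by rewrite ltW// divr_gt0.
by apply: h; rewrite normrZ ger0_norm ?divfK ?gt_eqF// ltW// divr_gt0.
Qed.

(** The supremum is attained: otherwise a neighbourhood of [bd c t] would miss the closed set [K],
    although points of [K] on the ray come arbitrarily close. *)
Lemma bd_in t : K (bd c t).
Proof.
apply: contrapT => nK.
have : nbhs (bd c t) (~` K) by apply: open_nbhs_nbhs; split=> //; exact: closed_openC.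
have cf : (c + p *: dir t) @[p --> rad c t] --> bd c t.
  by apply: cvgD; [exact: cvg_cst|apply: cvgZr_tmp; exact: cvg_id].
move=> /cf /nbhs_ballP[e /= e0 h].
have [p [p0 Kp] pr] := sup_adherent e0 (rad_has_sup t).
apply: (h p) => //; rewrite -ball_normE /= ger0_norm; last by rewrite subr_ge0 rad_ub.
by rewrite ltrBlDr -ltrBlDl.
Qed.

Lemma interior_lt_rad p t : 0 <= p < rad c t -> interior K (c + p *: dir t).
Proof.
move=> /andP[p0 pr]; have r0 := rad_gt0 t.
rewrite (_ : c + _ = (1 - p / rad c t) *: c + (p / rad c t) *: bd c t).
  apply: interior_comb => //; first exact: bd_in.
  by rewrite divr_ge0 ?(ltW r0)//= ltr_pdivrMr ?mul1r.
by rewrite scalerDr scalerA divfK ?gt_eqF// addrA -scalerDl subrK scale1r.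
Qed.

Lemma bd_boundary t : boundary K (bd c t).
Proof.
split; first exact/subset_closure/bd_in.
move=> int; have [e e0 h] := @interior_ball (bd c t) int.
have := @rad_ub (rad c t + e / `|dir t|) t; rewrite scalerDl addrA -/(bd c t).
have n0 : 0 < `|dir t|.
  rewrite normr_gt0; apply/eqP => E; have := dir_norm 1 t.
  by rewrite E scaler0 !mxE expr0n expr1n /= addr0 => /esym/eqP; rewrite oner_eq0.
have en : 0 < e / `|dir t| by rewrite divr_gt0.
have r0 := rad_gt0 t.
have -> : rad c t + e / `|dir t| <= rad c t = false by apply/negbTE; lra.
move=> H; suff : false by []; apply: H; first by lra.
by apply: h; rewrite normrZ gtr0_norm// divfK// gt_eqF.
Qed.

Lemma bd_angle t : at_angle c t (bd c t).
Proof. by exists (rad c t); rewrite ?rad_gt0. Qed.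

Lemma bd_unique t x : boundary K x -> at_angle c t x -> x = bd c t.
Proof.
move=> bx [p p0 E]; rewrite -/(dir t) in E.
have Kx := boundary_sub bx; rewrite E in Kx.
have := rad_ub (ltW p0) Kx; rewrite le_eqVlt => /orP[/eqP pr|pr].
  by rewrite E pr.
by case: (boundary_notin_interior bx); rewrite E; apply: interior_lt_rad; rewrite ltW.
Qed.

Lemma bdD2pi t : bd c (t + 2 * pi) = bd c t.
Proof.
apply/esym/bd_unique; first exact: bd_boundary.
by apply: (at_angleD2pi _ _ _).1; exact: bd_angle.
Qed.

Lemma bd_inj s t : bd c s = bd c t -> `|s - t| < 2 * pi -> s = t.
Proof.
move=> E; apply: (@at_angle_inj _ c _ _ (bd c s)); first exact: bd_angle.
by rewrite E; exact: bd_angle.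
Qed.

Lemma boundary_neq_center x : boundary K x -> x <> c.
Proof. by move=> /boundary_notin_interior h E; apply: h; rewrite E. Qed.

Lemma bd_surj s x : boundary K x ->
  exists t, [/\ s < t, t <= s + 2 * pi & x = bd c t].
Proof.
move=> bx; have [t [h1 h2 h3]] := at_angle_window s (boundary_neq_center bx).
by exists t; split => //; exact: bd_unique.
Qed.

(** The hull of a ball about [c] and the point [bd c t] already contains a definite part of the ray
    in direction [s], which bounds [rad c s] from below. This yields the continuity of [bd c]. *)
Lemma rad_lipschitz : exists2 L, 0 < L &
  forall s t, rad c t - rad c s <= L * `|dir s - dir t|.
Proof.
have [e e0 h] := interior_ball intc; have [M hM] := rad_bounded.
have radM t : rad c t <= M by apply: (hM _ t); rewrite ?ltW ?rad_gt0//; exact: bd_in.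
have M0 : 0 < M by apply: (lt_le_trans (rad_gt0 0)).
exists (M * M / e); first by rewrite divr_gt0 ?mulr_gt0.
move=> s t; set n := `|dir s - dir t|.
have n_ge0 : 0 <= n by exact: normr_ge0.
have rs := rad_gt0 s; have rt := rad_gt0 t.
have [n0|n0] := eqVneq n 0.
  move: n0 => /eqP; rewrite normr_eq0 subr_eq0 => /eqP E.
  by rewrite /n E subrr normr0 mulr0 /rad E subrr.
have n_gt0 : 0 < n by rewrite lt_neqAle eq_sym n0.
(* Chosen so that the two multiples of [dir t] cancel in the convex combination below and only a
   multiple of [dir s] remains. *)
set D := e + rad c t * n.
have D0 : 0 < D by rewrite addr_gt0 ?mulr_gt0.
have key : rad c t * e / D <= rad c s.
  apply: rad_ub; first by rewrite divr_ge0 ?mulr_ge0 ?ltW.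
  rewrite (_ : c + _ = (1 - e / D) *: (c + (e / n) *: (dir s - dir t)) + (e / D) *: bd c t).
    apply: cvx; last by rewrite divr_ge0 ?(ltW e0) ?(ltW D0)//= ler_pdivrMr// mul1r lerDl mulr_ge0 ?(ltW rt).
    - by apply: h; rewrite normrZ ger0_norm ?divr_ge0 ?(ltW e0)// -/n divfK.
    - exact: bd_in.
  rewrite /bd !scalerDr addrACA -scalerDl subrK scale1r; congr (_ + _).
  rewrite !scalerA (_ : (1 - e / D) * (e / n) = rad c t * e / D); last first.
    by rewrite /D; field; rewrite n0 gt_eqF.
  rewrite scalerN (_ : e / D * rad c t = rad c t * e / D); last by ring.
  by rewrite subrK.
have key2 : rad c t * e <= rad c s * D by rewrite -ler_pdivrMr.
have hs := radM s; have ht := radM t.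
rewrite mulrAC ler_pdivlMr//.
have : rad c s * rad c t * n <= M * M * n.
  by rewrite ler_pM2r// ler_pM// ltW.
by move: key2; rewrite /D; nra.
Qed.

Lemma bd_continuous : continuous (bd c).
Proof.
have [L L0 lip] := rad_lipschitz.
move=> t; apply: cvgD; first exact: cvg_cst.
apply: cvgZ; last exact: dir_continuous.
apply/cvgrPdist_lt => e e0.
have h : \forall s \near t, `|dir t - dir s| < e / L.
  by move: (@dir_continuous t) => /cvgrPdist_lt; apply; rewrite divr_gt0.
near=> s.
have : `|dir t - dir s| < e / L by near: s.
rewrite ltr_pdivlMr// => hs; apply: (le_lt_trans _ hs).
rewrite ler_norml; apply/andP; split.
- by rewrite lerNl opprB mulrC; exact: lip.
- by rewrite distrC mulrC; exact: lip.
Unshelve. all: by end_near. Qed.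

End Center.
End ConvexBody.

(** * The cyclic order of boundary points does not depend on the center *)

Section CyclicOrder.
Context {R : realType}.
Implicit Types (c d e x y z : plane R) (s t u : R).

Lemma orient_rot x y z : orient x y z = orient y z x.
Proof. by rewrite /orient; ring. Qed.

Lemma orient_swap x y z : orient x z y = - orient x y z.
Proof. by rewrite /orient; ring. Qed.

Lemma orient_split c x y z :
  orient x y z = orient c x y + orient c y z + orient c z x.
Proof. by rewrite /orient; ring. Qed.

Lemma orient_comb t c d x y : orient ((1 - t) *: c + t *: d) x y =
  (1 - t) * orient c x y + t * orient d x y.
Proof. by rewrite /orient !mxE; ring. Qed.

Lemma sin_eq0_2pi t : 0 < t <= 2 * pi -> sin t = 0 -> t = pi \/ t = 2 * pi.
Proof.
move=> /andP[t0]; rewrite le_eqVlt => /orP[/eqP|t2]; first by right.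
have [tp|pt|->] := ltgtP t pi; last by left.
- by have := @sin_gt0_pi R t; rewrite t0 tp => /(_ isT) h E; move: h; rewrite E ltxx.
- by have := @sin_lt0_pi R t; rewrite pt t2 => /(_ isT) h E; move: h; rewrite E ltxx.
Qed.

(* The three gaps add up to a full turn, so at most one of them reaches pi. *)
Lemma ccw_orient c x y z s t u :
  at_angle c s x -> at_angle c t y -> at_angle c u z ->
  s < t -> t < u -> u < s + 2 * pi ->
  [\/ 0 < orient c x y /\ 0 < orient c y z,
      0 < orient c y z /\ 0 < orient c z x |
      0 < orient c z x /\ 0 < orient c x y].
Proof.
move=> [p p0 ->] [q q0 ->] [r r0 ->] st tu us; rewrite -!/(dir _).
rewrite !orient_dir.
have h1 : t - s < pi -> 0 < p * q * sin (t - s).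
  by move=> h; rewrite !mulr_gt0// sin_gt0_pi//; apply/andP; split; lra.
have h2 : u - t < pi -> 0 < q * r * sin (u - t).
  by move=> h; rewrite !mulr_gt0// sin_gt0_pi//; apply/andP; split; lra.
have h3 : s + 2 * pi - u < pi -> 0 < r * p * sin (s - u).
  move=> h; rewrite !mulr_gt0//.
  rewrite -(sinD2pi (s - u)) sin_gt0_pi// -mulr_natl; apply/andP; split; lra.
have [a1|a1] := ltP (t - s) pi; have [a2|a2] := ltP (u - t) pi.
- by constructor 1; split; [exact: h1|exact: h2].
- by constructor 3; split; [apply: h3; lra|exact: h1].
- by constructor 2; split; [exact: h2|apply: h3; lra].
- lra.
Qed.

Variable K : set (plane R).
Hypotheses (cvxK : @convex_set R (plane R) K) (cptK : compact K).

Let cvx x y t : K x -> K y -> 0 <= t <= 1 -> K ((1 - t) *: x + t *: y).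
Proof. by move: cvxK => /convex_setE; apply. Qed.

(** The orientation is a positive multiple of the sine of the angle difference, so the difference is
    half a turn or a full one, and a full turn would identify [x] and [y]. *)
Lemma opposite_on_line e x y s : interior K e -> boundary K x -> boundary K y ->
  x <> y -> orient e x y = 0 -> x = bd K e s -> y = bd K e (s + pi).
Proof.
move=> ie bx by_ xy o xs.
have [u [su us yu]] := bd_surj cvxK cptK ie s by_.
move: o; rewrite xs yu /bd orient_dir => /eqP.
rewrite !mulf_eq0 !(gt_eqF (rad_gt0 cptK ie _)) /= => /eqP E.
have [|h|h] := @sin_eq0_2pi (u - s) _ E.
- by apply/andP; split; lra.
- by rewrite (_ : u = s + pi) //; lra.
- exfalso; apply: xy; rewrite xs yu (_ : u = s + 2 * pi) ?(bdD2pi cvxK cptK ie)//; lra.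
Qed.

(** The signs place [y] between [x] and [z] as seen from [c], but strictly before their chord. So
    [y] is a convex combination of [c], [x], [z] with positive weight on the interior point [c]. *)
Lemma not_interior_comb3 c x y z : interior K c -> K x -> boundary K y -> K z ->
  orient c x y * orient x y z < 0 -> orient c y z * orient x y z < 0 -> False.
Proof.
move=> ic Kx by_ Kz; set g1 := orient c x y; set g2 := orient c y z.
set o := orient x y z => h1 h2.
have o0 : o != 0 by apply/eqP => E; move: h1; rewrite E mulr0 ltxx.
set g3 := orient c z x.
have oE : o = g1 + g2 + g3 by exact: orient_split.
have g3o : 0 < g3 * o by rewrite (_ : g3 = o - g1 - g2) ?oE; nra.
have g30 : g3 != 0 by apply/eqP => E; move: g3o; rewrite E mul0r ltxx.
have g12 : g1 + g2 != 0.
  by apply/eqP => E; have := h1; have := h2; have := congr1 ( *%R^~ o) E; rewrite mul0r; lra.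
apply: (boundary_notin_interior by_).
(* [m] is the point where the ray from [c] through [y] meets the chord from [x] to [z], and [k] is
   the fraction of the way to [m] at which [y] lies. *)
pose w := g1 / (g1 + g2); pose m := (1 - w) *: x + w *: z.
pose k := - (g1 + g2) / g3.
have Km : K m.
  apply: cvx => //; rewrite /w (_ : g1 / _ = (g1 * o) / (g1 * o + g2 * o)); last first.
    by field; rewrite -?mulrDl ?mulf_neq0 ?o0 ?g12.
  by rewrite ler_ndivlMr ?ler_ndivrMr ?mul0r ?mul1r; lra.
suff -> : y = (1 - k) *: c + k *: m.
  apply: interior_comb => //.
  rewrite /k (_ : _ / _ = (- (g1 * o + g2 * o)) / (g3 * o)); last by field; rewrite o0 g30.
  rewrite ler_pdivlMr// ltr_pdivrMr// mul0r mul1r; apply/andP; split; first lra.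
  by have : 0 < o * o; [rewrite -expr2 exprn_even_gt0|rewrite {1}oE; lra].
have K1 : g3 *: y = (g3 + (g1 + g2)) *: c - (g2 *: x + g1 *: z).
  by apply: plane_eq; rewrite !mxE /g1 /g2 /g3 /orient; ring.
apply: (scalerI g30); rewrite K1 /m /w /k.
apply: plane_eq; rewrite !mxE; field; by rewrite g30 g12.
Qed.

(** The centers lie on opposite sides of the common line, so the segment between them crosses it at
    an interior point [e]. Seen from [e], both [y] and [z] are opposite to [x], hence equal. *)
Lemma not_ccw_collinear c d x y z : interior K c -> interior K d ->
  boundary K x -> boundary K y -> boundary K z -> y <> z -> z <> x ->
  orient x y z = 0 -> 0 < orient c x y -> orient d x y < 0 -> False.
Proof.
move=> ic id bx by_ bz yz zx o f g.
have xy : x <> y by move=> E; move: f; rewrite E /orient; nra.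
pose t := orient c x y / (orient c x y - orient d x y).
pose e := (1 - t) *: c + t *: d.
have D0 : 0 < orient c x y - orient d x y by lra.
have ie : interior K e.
  apply: interior_comb => //; first exact: interior_subset.
  by rewrite /t ler_pdivlMr// ltr_pdivrMr//; apply/andP; split; lra.
have oe : orient e x y = 0.
  by rewrite orient_comb /t; field; rewrite gt_eqF.
have oz : orient e x z = 0.
  (* Some coordinate of [y - x] is nonzero, and collinearity is deduced by cancelling it. *)
  have [E|E] := eqVneq (y 0 0) (x 0 0).
  - have E1 : y 0 1 - x 0 1 != 0.
      by apply/eqP => E1; apply: xy; apply: plane_eq => //; lra.
    apply: (mulfI E1); rewrite mulr0.
    rewrite (_ : _ * _ = (x 0 1 - e 0 1) * orient x y z + (z 0 1 - x 0 1) * orient e x y).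
      by rewrite o oe; ring.
    by rewrite /orient; ring.
  - rewrite -subr_eq0 in E; apply: (mulfI E); rewrite mulr0.
    rewrite (_ : _ * _ = (x 0 0 - e 0 0) * orient x y z + (z 0 0 - x 0 0) * orient e x y).
      by rewrite o oe; ring.
    by rewrite /orient; ring.
have [s [_ _ xs]] := bd_surj cvxK cptK ie 0 bx.
apply: yz; rewrite (opposite_on_line ie bx by_ xy oe xs).
by rewrite -(opposite_on_line ie bx bz _ oz xs)// => E; apply: zx.
Qed.

(** A triangle of negative orientation contradicts the signs at [c], and one of positive orientation
    those at [d]. In the degenerate case two of three orientations are positive at [c] and two are
    negative at [d], so some pair has both signs. *)
Lemma ccw_center c d x y z : interior K c -> interior K d ->
  boundary K x -> boundary K y -> boundary K z -> x <> y -> y <> z -> z <> x ->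
  [\/ 0 < orient c x y /\ 0 < orient c y z,
      0 < orient c y z /\ 0 < orient c z x |
      0 < orient c z x /\ 0 < orient c x y] ->
  [\/ orient d x y < 0 /\ orient d y z < 0,
      orient d y z < 0 /\ orient d z x < 0 |
      orient d z x < 0 /\ orient d x y < 0] -> False.
Proof.
move=> ic id bx by_ bz xy yz zx.
have Kx := boundary_sub cptK bx; have Ky := boundary_sub cptK by_.
have Kz := boundary_sub cptK bz.
have o1 : orient x y z = orient y z x by exact: orient_rot.
have o2 : orient x y z = orient z x y by rewrite orient_rot orient_rot.
have [on|op|o0] := ltgtP (orient x y z) 0.
- move=> + _ => -[] [h1 h2].
  + by apply: (@not_interior_comb3 c x y z) => //; nra.
  + by apply: (@not_interior_comb3 c y z x) => //; rewrite -o1; nra.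
  + by apply: (@not_interior_comb3 c z x y) => //; rewrite -o2; nra.
- move=> _ [] [h1 h2].
  + by apply: (@not_interior_comb3 d x y z) => //; nra.
  + by apply: (@not_interior_comb3 d y z x) => //; rewrite -o1; nra.
  + by apply: (@not_interior_comb3 d z x y) => //; rewrite -o2; nra.
- have h1 := @not_ccw_collinear c d x y z ic id bx by_ bz yz zx o0.
  have h2 := @not_ccw_collinear c d y z x ic id by_ bz bx zx xy (etrans (esym o1) o0).
  have h3 := @not_ccw_collinear c d z x y ic id bz bx by_ xy yz (etrans (esym o2) o0).
  by move=> [] [f1 f2] [] [g1 g2]; auto.
Qed.

(** If the order were reversed at [d], the three points would be counterclockwise around [c] and
    clockwise around [d], which [ccw_center] excludes. *)
Lemma ccw_transfer c d s t u s' t' u' : interior K c -> interior K d ->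
  bd K c s = bd K d s' -> bd K c t = bd K d t' -> bd K c u = bd K d u' ->
  s < t -> t < u -> u < s + 2 * pi ->
  s' < t' -> t' < s' + 2 * pi -> s' < u' -> u' < s' + 2 * pi -> t' < u'.
Proof.
move=> ic id es et eu st tu us s't' t's' s'u' u's'.
have bdry := bd_boundary cptK.
have dist c' p q : interior K c' -> p < q -> q < p + 2 * pi -> bd K c' p <> bd K c' q.
  move=> ic' pq qp /(bd_inj cptK ic') E.
  have : p = q by apply: E; rewrite ltr_norml; apply/andP; split; lra.
  by move=> E'; move: pq; rewrite E' ltxx.
have [//|u't'|E] := ltgtP t' u'; last first.
  by exfalso; apply: (dist c t u ic) => //; [lra|rewrite et eu E].
exfalso; apply: (@ccw_center c d (bd K c s) (bd K c t) (bd K c u)) => //.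
- exact: bdry.
- exact: bdry.
- exact: bdry.
- by apply: (dist c) => //; lra.
- by apply: (dist c) => //; lra.
- by move=> E; apply: (dist c s u ic _ us (esym E)); lra.
- by apply: (@ccw_orient c _ _ _ s t u) => //; exact: bd_angle.
have := @ccw_orient d (bd K d s') (bd K d u') (bd K d t') s' u' t'.
have ang := bd_angle cptK id.
move=> /(_ (ang _) (ang _) (ang _) s'u' u't' t's').
rewrite es et eu.
rewrite (orient_swap d (bd K d t') (bd K d s')) (orient_swap d (bd K d u') (bd K d t')).
rewrite (orient_swap d (bd K d s') (bd K d u')) !oppr_lt0.
by case=> -[h1 h2]; [constructor 2|constructor 1|constructor 3].
Qed.

End CyclicOrder.

(** * Chords, pockets and arcs *)

Section Chords.
Context {R : realType}.
Implicit Types (c e v w x y z : plane R) (s t u : R).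

Lemma seg_left x y : seg x y x.
Proof.
by exists 0; rewrite /= ?in_itv /= ?lexx ?ler01// subr0 scale1r scale0r addr0.
Qed.

Lemma seg_sym x y : seg x y = seg y x.
Proof.
suff sub (p q : plane R) : seg p q `<=` seg q p by apply/seteqP; split; exact: sub.
move=> z [t /= /[!in_itv] /= /andP[t0 t1] <-]; exists (1 - t) => /=.
  by rewrite in_itv /=; apply/andP; split; lra.
by rewrite subKr addrC.
Qed.

Lemma seg_right x y : seg x y y.
Proof. by rewrite seg_sym; exact: seg_left. Qed.

Lemma seg_sub (A : set (plane R)) x y :
  @convex_set R (plane R) A -> A x -> A y -> seg x y `<=` A.
Proof.
by move=> /convex_setE cA Ax Ay z [t /= /[!in_itv] /= t01 <-]; exact: cA.
Qed.

Lemma seg_convex x y : @convex_set R (plane R) (seg x y).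
Proof.
apply/convex_setE => z w t [p /= /[!in_itv] /= /andP[p0 p1] <-].
move=> [q /= /[!in_itv] /= /andP[q0 q1] <-] /andP[t0 t1].
exists ((1 - t) * p + t * q); last by apply: plane_eq; rewrite !mxE; ring.
rewrite /= in_itv /=; apply/andP; split; nra.
Qed.

Lemma orient_seg x y z : seg x y z -> orient x y z = 0.
Proof. by move=> [t _ <-]; rewrite /orient !mxE; ring. Qed.

Lemma orient_combr t x y v z : orient x y ((1 - t) *: v + t *: z) =
  (1 - t) * orient x y v + t * orient x y z.
Proof. by rewrite -orient_rot orient_comb -!(orient_rot _ x y). Qed.

Lemma halfplane_convex x y : @convex_set R (plane R) [set z | 0 <= orient x y z].
Proof.
apply/convex_setE => v z t /= hv hz /andP[t0 t1].
by rewrite orient_combr; apply: addr_ge0; apply: mulr_ge0 => //; lra.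
Qed.

Variable K : set (plane R).
Hypotheses (cvxK : @convex_set R (plane R) K) (cptK : compact K).

Let cvx x y t : K x -> K y -> 0 <= t <= 1 -> K ((1 - t) *: x + t *: y).
Proof. by move: cvxK => /convex_setE; apply. Qed.

Lemma bd_neq c s t : interior K c -> s < t -> t < s + 2 * pi ->
  bd K c s <> bd K c t.
Proof.
move=> ic st ts /(bd_inj cptK ic) E.
have : s = t by apply: E; rewrite ltr_norml; apply/andP; split; lra.
by move=> E'; move: st; rewrite E' ltxx.
Qed.

Lemma bd_surj_neq c s x : interior K c -> boundary K x -> x <> bd K c s ->
  exists t, [/\ s < t, t < s + 2 * pi & x = bd K c t].
Proof.
move=> ic bx xs; have [t [st ts E]] := bd_surj cvxK cptK ic s bx.
exists t; split => //; rewrite lt_neqAle ts andbT; apply/eqP => Et.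
by apply: xs; rewrite E Et (bdD2pi cvxK cptK ic).
Qed.

Lemma boundaryP x : K x -> ~ interior K x -> boundary K x.
Proof. by move=> Kx nx; split => //; exact: subset_closure. Qed.

Lemma center_in_seg c s : interior K c -> seg (bd K c s) (bd K c (s + pi)) c.
Proof.
move=> ic; have r0 := rad_gt0 cptK ic s; have r1 := rad_gt0 cptK ic (s + pi).
exists (rad K c s / (rad K c s + rad K c (s + pi))) => /=.
  rewrite in_itv /= ler_pdivlMr ?addr_gt0// ler_pdivrMr ?addr_gt0//.
  by apply/andP; split; lra.
rewrite /bd dirDpi; apply: plane_eq; rewrite !mxE; field; rewrite gt_eqF ?addr_gt0//.
Qed.

Lemma sector c s t u : interior K c -> s < t -> t < u -> u < s + pi ->
  exists m, [/\ 0 < m, m <= rad K c t &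
    seg (bd K c s) (bd K c u) (c + m *: dir t)].
Proof.
move=> ic st tu us; set p := rad K c s; set q := rad K c u.
have p0 : 0 < p := rad_gt0 cptK ic s; have q0 : 0 < q := rad_gt0 cptK ic u.
have s1 : 0 < sin (u - t) by apply: sin_gt0_pi; apply/andP; split; lra.
have s2 : 0 < sin (t - s) by apply: sin_gt0_pi; apply/andP; split; lra.
have s3 : 0 < sin (u - s) by apply: sin_gt0_pi; apply/andP; split; lra.
have D0 : 0 < q * sin (u - t) + p * sin (t - s) by rewrite addr_gt0 ?mulr_gt0.
set D := q * _ + _ in D0.
(* The radius is the polar equation of the line through the two chord ends, evaluated at angle
   [t]. *)
have sg : seg (bd K c s) (bd K c u) (c + (p * q * sin (u - s) / D) *: dir t).
  exists (p * sin (t - s) / D) => /=.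
    rewrite in_itv /= ler_pdivlMr// ler_pdivrMr// mul0r mul1r.
    by rewrite lerDr !mulr_ge0 ?ltW.
  have Dn : D != 0 by rewrite gt_eqF.
  (* Both coordinates reduce to one sine identity, used with [f] the cosine and the sine. *)
  have E (f : R -> R) : sin (u - t) * f s + sin (t - s) * f u = sin (u - s) * f t ->
      (1 - p * sin (t - s) / D) * (p * f s) + p * sin (t - s) / D * (q * f u) =
      p * q * sin (u - s) / D * f t.
    move=> h; rewrite (_ : _ * f t = p * q / D * (sin (u - s) * f t)); last by field.
    by rewrite -h /D; field.
  rewrite /bd -/p -/q !scalerDr addrACA -scalerDl subrK scale1r; congr (_ + _).
  by apply: plane_eq; rewrite !mxE /=; apply: E; rewrite !sinB; ring.
exists (p * q * sin (u - s) / D); split => //; first by rewrite !mulr_gt0 ?invr_gt0.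
apply: rad_ub => //; first by rewrite !mulr_ge0 ?invr_ge0 ?ltW.
by apply: (seg_sub cvxK _ _ sg); exact: bd_in.
Qed.

(** The ray at angle [t] meets the chord. Meeting it before the boundary would put an interior point
    on the chord's line, so it meets it exactly at [bd K c t]. *)
Lemma flat_sector c s t u : interior K c -> s < t -> t < u -> u < s + pi ->
  (forall e, interior K e -> orient (bd K c s) (bd K c u) e <> 0) ->
  seg (bd K c s) (bd K c u) (bd K c t).
Proof.
move=> ic st tu us flat; have [m [m0 mr sg]] := sector ic st tu us.
move: mr; rewrite le_eqVlt => /orP[/eqP E|mr]; first by rewrite /bd -E.
exfalso; apply: (flat (c + m *: dir t)); last exact: orient_seg.
by apply: interior_lt_rad => //; rewrite ltW.
Qed.

Lemma line_in_seg e s y : interior K e -> K y ->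
  orient (bd K e s) (bd K e (s + pi)) y = 0 ->
  seg (bd K e s) (bd K e (s + pi)) y.
Proof.
move=> ie Ky; have [->|/eqP ye o] := eqVneq y e; first by move=> _; exact: center_in_seg.
have [t [st ts [q q0 yE]]] := at_angle_window s ye; rewrite -/(dir t) in yE.
set p := rad K e s; set p' := rad K e (s + pi).
have p0 : 0 < p := rad_gt0 cptK ie s.
have p0' : 0 < p' := rad_gt0 cptK ie (s + pi).
have qr : q <= rad K e t by apply: rad_ub; rewrite ?ltW// -yE.
have P0 : 0 < p + p' by rewrite addr_gt0.
(* [l] is the signed coordinate along the line with origin [e]; the two radii bound it on either
   side. *)
suff [l [l1 l2 ->]] : exists l : R, [/\ - p' <= l, l <= p & y = e + l *: dir s].
  exists ((p - l) / (p + p')) => /=.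
    by rewrite in_itv /= ler_pdivlMr// ler_pdivrMr//; apply/andP; split; lra.
  by rewrite /bd dirDpi -/p -/p'; apply: plane_eq; rewrite !mxE; field; rewrite gt_eqF.
have o' : (p + p') * q * sin (t - s) = 0.
  move: o; rewrite (orient_split e) yE /bd !orient_dir -/p -/p'.
  rewrite (_ : s + pi - s = 0 + pi); last by ring.
  rewrite (_ : t - (s + pi) = (t - s) - pi); last by ring.
  rewrite (_ : s - t = - (t - s)); last by ring.
  rewrite sinDpi sin0 sinN -[sin (t - s - pi)]opprK -sinDpi subrK; lra.
move/eqP: o'; rewrite !mulf_eq0 (gt_eqF P0) (gt_eqF q0) /= => /eqP o'.
have [|h|h] := @sin_eq0_2pi _ (t - s) _ o'; first by apply/andP; split; lra.
- have tE : t = s + pi by lra.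
  exists (- q); split; [|by lra|by rewrite yE tE dirDpi scalerN scaleNr].
  by rewrite lerN2 /p' -tE.
- have tE : t = s + 2 * pi by lra.
  exists q; split; [by lra| |by rewrite yE tE dirD2pi].
  by rewrite (le_trans qr)// /rad tE dirD2pi.
Qed.

Section Center.
Variable c : plane R.
Hypothesis ic : interior K c.
Local Notation b := (bd K c).

(** The hull of the complementary arc, from [b t] onwards to [b s]. The points of [K] outside it
    form the pocket cut off by the chord from [b s] to [b t]. *)
Definition arc_hull s t : set (plane R) :=
  convex_hull [set b u | u in `[t, s + 2 * pi]].

Lemma arc_hull_bd s t u : t <= u -> u <= s + 2 * pi -> arc_hull s t (b u).
Proof.
by move=> tu us; apply: convex_hull_sub; exists u => //=; rewrite in_itv /= tu.
Qed.

Lemma arc_hull_convex s t : @convex_set R (plane R) (arc_hull s t).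
Proof. exact: convex_hull_convex. Qed.

Lemma arc_hullS s t t' : t <= t' -> arc_hull s t' `<=` arc_hull s t.
Proof.
move=> tt'; apply: convex_hull_min; first exact: arc_hull_convex.
move=> _ [u /= /[!in_itv] /= /andP[h1 h2] <-].
by apply: arc_hull_bd => //; exact: le_trans h1.
Qed.

(* If the line through the ends of the chord meets the interior, it splits [K]
   in two; otherwise it supports [K], and either the arc or its complement is
   the chord itself. *)
Lemma chord_crossing s t u z : s < t -> t < u -> u < s + 2 * pi ->
  K z -> arc_hull s u z ->
  exists2 y, seg (b t) z y & seg (b s) (b u) y.
Proof.
move=> st tu us Kz Hz.
have bdry k : boundary K (b k) by exact: bd_boundary.
have su : s < u by exact: lt_trans tu.
have [[e ie oe]|flat] := pselect (exists2 e, interior K e & orient (b s) (b u) e = 0).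
  (* Recentred at a point [e] of the chord's line, the chord ends are opposite, and the side of the
     line is read off from the sign of a sine. *)
  have [s' [_ _ bs]] := bd_surj cvxK cptK ie 0 (bdry s).
  have bu : b u = bd K e (s' + pi).
    by apply: opposite_on_line bs => //; [exact: bd_neq|rewrite orient_rot].
  have pi0 := @pi_gt0 R.
  have ang (k : R) : s < k -> k < s + 2 * pi ->
      exists k', [/\ s' < k', k' < s' + 2 * pi & b k = bd K e k'].
    by move=> sk ks; apply: bd_surj_neq => //; rewrite -bs => /esym; exact: bd_neq.
  have orE (k : R) : orient (b s) (b u) (bd K e k) =
      - (rad K e k * (rad K e s' + rad K e (s' + pi)) * sin (k - s')).
    rewrite bs bu (orient_split e) /bd !orient_dir.
    rewrite (_ : s' + pi - s' = 0 + pi); last by ring.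
    rewrite (_ : k - (s' + pi) = (k - s') - pi); last by ring.
    rewrite (_ : s' - k = - (k - s')); last by ring.
    rewrite sinDpi sin0 sinN -[sin (k - s' - pi)]opprK -sinDpi subrK; ring.
  have r0 (k : R) : 0 < rad K e k by exact: rad_gt0.
  have vneg : orient (b s) (b u) (b t) < 0.
    have [t' [st' ts' E]] : exists t', [/\ s' < t', t' < s' + 2 * pi & b t = bd K e t'].
      by apply: ang => //; exact: lt_trans us.
    have tlt : t' < s' + pi by apply: (ccw_transfer cvxK cptK ic ie bs E bu) => //; lra.
    rewrite E orE oppr_lt0 !mulr_gt0 ?addr_gt0// sin_gt0_pi//; apply/andP; split; lra.
  have zpos : 0 <= orient (b s) (b u) z.
    move: z Hz {Kz}; apply: convex_hull_min; first exact: halfplane_convex.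
    move=> _ [x /= /[!in_itv] /= /andP[ux xs] <-].
    move: ux; rewrite le_eqVlt => /orP[/eqP <-|ux]; first by rewrite orient_seg//; exact: seg_right.
    move: xs; rewrite le_eqVlt => /orP[/eqP ->|xs].
      by rewrite (bdD2pi cvxK cptK ic) orient_seg//; exact: seg_left.
    have [x' [sx' xs' E]] := ang x (lt_trans su ux) xs.
    have xgt : s' + pi < x' by apply: (ccw_transfer cvxK cptK ic ie bs bu E) => //; lra.
    rewrite E orE oppr_ge0 mulr_ge0_le0//; first by rewrite mulr_ge0 ?addr_ge0 ?ltW.
    by apply/ltW/sin_lt0_pi; apply/andP; split; lra.
  set ov := orient (b s) (b u) (b t) in vneg *; set oz := orient _ _ z in zpos *.
  (* The affine function [orient (b s) (b u)] goes from [ov < 0] at [b t] to [oz >= 0] at [z]; [k]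
     is its zero. *)
  pose k := ov / (ov - oz).
  have k01 : 0 <= k <= 1 by rewrite /k ler_ndivlMr ?ler_ndivrMr; lra.
  exists ((1 - k) *: b t + k *: z); first by exists k => //=; rewrite in_itv.
  rewrite bs bu; apply: line_in_seg => //; first by apply: cvx => //; exact: bd_in.
  rewrite -bs -bu orient_combr -/ov -/oz /k; field.
  by rewrite lt_eqF//; lra.
have {}flat e : interior K e -> orient (b s) (b u) e <> 0.
  by move=> ie oe; apply: flat; exists e.
have [h|h] := ltP u (s + pi).
  by exists (b t); [exact: seg_left|exact: flat_sector].
have {}h : s + pi < u.
  rewrite lt_neqAle h andbT; apply/eqP => E; apply: (flat c ic).
  by apply: orient_seg; rewrite -E; exact: center_in_seg.
(* The complementary arc is now less than half a turn and lies on the chord, as does its hull, so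
   [z] itself is the crossing point. *)
exists z; first exact: seg_right.
move: z Hz {Kz}; apply: convex_hull_min; first exact: seg_convex.
move=> _ [x /= /[!in_itv] /= /andP[ux xs] <-].
move: ux; rewrite le_eqVlt => /orP[/eqP <-|ux]; first exact: seg_right.
move: xs; rewrite le_eqVlt => /orP[/eqP ->|xs].
  by rewrite (bdD2pi cvxK cptK ic); exact: seg_left.
rewrite seg_sym -[b s](bdD2pi cvxK cptK ic); apply: flat_sector => //; first by lra.
move=> e ie; rewrite (bdD2pi cvxK cptK ic) orient_rot orient_swap => /eqP.
by rewrite oppr_eq0 => /eqP; exact: flat.
Qed.

(* In terms of the angle seen from [w]: a point outside all these hulls sees
   each of the two arcs under an angle of at least [pi], and sees the rest of
   the boundary under a positive angle. *)
Lemma pockets_disjoint s t s' t' T w :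
  s < t -> t <= s' -> s' < t' -> t' < T -> T <= s + 2 * pi -> K w ->
  (forall u, t < u -> u < T -> ~ arc_hull s u w) ->
  (forall u, t' < u -> u < T -> ~ arc_hull s' u w) -> False.
Proof.
move=> st ts' st' tT Ts Kw h h'.
have bdry (k : R) : boundary K (b k) by exact: bd_boundary.
have pi0 := @pi_gt0 R.
have between (x : R) : t' < x -> exists u, [/\ t' < u, u < T & u <= x].
  move=> tx; exists ((t' + Num.min x T) / 2).
  have : t' < Num.min x T by rewrite lt_min tx.
  have : Num.min x T <= x by rewrite ge_min lexx.
  have : Num.min x T <= T by rewrite ge_min lexx orbT.
  by move=> *; split; lra.
(* A [w] on the boundary is some [b x]; it lies on the complementary arc of the first step if
   [x <= t'], and on that of the second otherwise. *)
have [iw|nw] := pselect (interior K w); last first.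
  have [x [sx xs E]] := bd_surj cvxK cptK ic s' (boundaryP Kw nw).
  have [xt|xt] := leP x t'.
    by apply: (h ((t + x) / 2)); [lra|lra|rewrite E; apply: arc_hull_bd; lra].
  have [u [tu uT ux]] := between x xt.
  by apply: (h' u) => //; rewrite E; apply: arc_hull_bd => //; lra.
have [d [_ _ dE]] := bd_surj cvxK cptK iw 0 (bdry s').
have bdryw (k : R) : boundary K (bd K w k) by exact: bd_boundary.
(* [b x] is the far end of the chord through [w] from [b s']. If it lay beyond [t'], this chord
   would put [w] into the second hull. *)
have [x [sx xs E]] : exists x : R, [/\ s' < x, x < s' + 2 * pi & bd K w (d + pi) = b x].
  by apply: bd_surj_neq => //; rewrite dE => /esym; apply: bd_neq => //; lra.
have xt : x <= t'.
  rewrite leNgt; apply/negP => tx; have [u [tu uT ux]] := between x tx.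
  apply: (h' u) => //; apply: (seg_sub (@arc_hull_convex s' u) _ _ (center_in_seg d iw)).
  - by rewrite -dE -(bdD2pi cvxK cptK ic); apply: arc_hull_bd; lra.
  - by rewrite E; apply: arc_hull_bd; lra.
have [a [da ad aE]] : exists a, [/\ d < a, a < d + 2 * pi & b (s + 2 * pi) = bd K w a].
  by apply: bd_surj_neq => //; rewrite -dE => /esym; apply: bd_neq => //; lra.
have dpa : d + pi < a.
  by apply: (ccw_transfer cvxK cptK ic iw dE (esym E) aE); lra.
(* The chord is rotated about [w] by half the available slack. Its first end moves strictly past
   [s'], hence past [t], and its second end stays before [s + 2 * pi], so [w] falls into the first
   hull. *)
pose r := (a - d - pi) / 2.
have [x1 [sx1 x1s E1]] : exists y : R, [/\ s' < y, y < s' + 2 * pi & bd K w (d + r) = b y].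
  by apply: bd_surj_neq => //; rewrite dE /r => /esym; apply: bd_neq => //; lra.
have [x2 [sx2 x2s E2]] : exists y : R, [/\ s' < y, y < s' + 2 * pi & bd K w (d + r + pi) = b y].
  by apply: bd_surj_neq => //; rewrite dE /r => /esym; apply: bd_neq => //; lra.
have l1 : x1 < x.
  by apply: (ccw_transfer cvxK cptK iw ic (esym dE) E1 E); rewrite /r; lra.
have l2 : x < x2.
  by apply: (ccw_transfer cvxK cptK iw ic (esym dE) E E2); rewrite /r; lra.
have l3 : x2 < s + 2 * pi.
  by apply: (ccw_transfer cvxK cptK iw ic (esym dE) E2 (esym aE)); rewrite /r; lra.
apply: (h x1); [lra|lra|].
apply: (seg_sub (@arc_hull_convex s x1) _ _ (center_in_seg (d + r) iw)).
- by rewrite E1; apply: arc_hull_bd; lra.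
- by rewrite E2; apply: arc_hull_bd; lra.
Qed.

(** An arc may be witnessed by any interior point; [ccw_transfer] carries the order of the angles
    from that witness to the fixed center [c]. *)
Lemma arc_oo_bd s u x : s < u -> u <= s + 2 * pi ->
  arc_oo K (b s) (b u) x -> exists t, [/\ s < t, t < u & x = b t].
Proof.
move=> su us [bx [d [s' [u' [t' [[id su' us' hs hu] /[!in_itv] /= /andP[st' tu'] hx]]]]]].
have bdry (k : R) : boundary K (b k) by exact: bd_boundary.
have es := bd_unique cvxK cptK id (bdry s) hs.
have eu := bd_unique cvxK cptK id (bdry u) hu.
have ex := bd_unique cvxK cptK id bx hx.
have [t [st ts E]] : exists t, [/\ s < t, t < s + 2 * pi & x = b t].
  by apply: bd_surj_neq => //; rewrite ex es => /esym; apply: bd_neq => //; lra.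
exists t; split => //.
(* On a full turn the two ends coincide, so there are no three distinct points to compare. *)
have [Eu|us2] := eqVneq u (s + 2 * pi); first by rewrite Eu.
have {us2}us : u < s + 2 * pi by rewrite lt_neqAle us2.
have us2 : u' < s' + 2 * pi.
  rewrite lt_neqAle us' andbT; apply/eqP => Eu'.
  apply: (bd_neq ic su us); rewrite es eu Eu' (bdD2pi cvxK cptK id)//.
have [//|ut|Et] := ltgtP t u; exfalso.
- have : u' < t' by apply: (ccw_transfer cvxK cptK ic id es eu (etrans (esym E) ex)) => //; lra.
  lra.
- by apply: (bd_neq id tu'); [lra|rewrite -ex -eu E Et].
Qed.

Lemma bd_arc_oo s t u : s < t -> t < u -> u <= s + 2 * pi ->
  arc_oo K (b s) (b u) (b t).
Proof.
move=> st tu us; split; first exact: bd_boundary.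
exists c, s, u, t; split; [split=> //|by rewrite in_itv /= st|exact: bd_angle].
- exact: lt_trans tu.
- exact: bd_angle.
- exact: bd_angle.
Qed.

Lemma arc_oc_bd s u x : s < u -> u <= s + 2 * pi ->
  arc_oc K (b s) (b u) x -> exists t, [/\ s < t, t <= u & x = b t].
Proof.
move=> su us [bx [d [s' [u' [t' [j /[!in_itv] /= /andP[st' tu'] hx]]]]]].
move: tu'; rewrite le_eqVlt => /orP[/eqP Et|tu'].
  case: j => id _ _ _ hu; exists u; split => //.
  rewrite (bd_unique cvxK cptK id bx hx) Et.
  by apply/esym/bd_unique => //; exact: bd_boundary.
have [|t [st tu E]] := @arc_oo_bd s u x su us.
  by split => //; exists d, s', u', t'; split => //; rewrite in_itv /= st'.
by exists t; split => //; exact: ltW.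
Qed.

Lemma bd_arc_oc s t u : s < t -> t <= u -> u <= s + 2 * pi ->
  arc_oc K (b s) (b u) (b t).
Proof.
move=> st tu us; split; first exact: bd_boundary.
exists c, s, u, t; split; [split=> //|by rewrite in_itv /= st|exact: bd_angle].
- exact: lt_le_trans tu.
- exact: bd_angle.
- exact: bd_angle.
Qed.

End Center.
End Chords.

(** * Eyelets, horizons and greedy chains *)

Section Euclidean.
Context {R : realType}.
Implicit Types (x y z q : plane R).

Lemma enorm_ge0 x : 0 <= enorm x. Proof. exact: sqrtr_ge0. Qed.

Lemma enorm_sqr x : enorm x ^+ 2 = x 0 0 ^+ 2 + x 0 1 ^+ 2.
Proof. by rewrite sqr_sqrtr// addr_ge0 ?sqr_ge0. Qed.

Lemma enormZ (a : R) x : enorm (a *: x) = `|a| * enorm x.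
Proof.
by rewrite /enorm !mxE !exprMn -mulrDr sqrtrM ?sqr_ge0// sqrtr_sqr.
Qed.

Lemma enormN x : enorm (- x) = enorm x.
Proof. by rewrite -scaleN1r enormZ normrN1 mul1r. Qed.

Lemma enormC x y : enorm (x - y) = enorm (y - x).
Proof. by rewrite -enormN opprB. Qed.

Lemma enormD x y : enorm (x + y) <= enorm x + enorm y.
Proof.
have hx := enorm_ge0 x; have hy := enorm_ge0 y.
have cs : x 0 0 * y 0 0 + x 0 1 * y 0 1 <= enorm x * enorm y.
  have [h|h] := leP (x 0 0 * y 0 0 + x 0 1 * y 0 1) 0.
    by apply: (le_trans h); exact: mulr_ge0.
  rewrite -(@ler_pXn2r _ 2%N)// ?nnegrE ?mulr_ge0// ?(ltW h)//.
  rewrite exprMn !enorm_sqr.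
  (* Lagrange's identity: this square is the gap in the Cauchy-Schwarz inequality. *)
  by have := sqr_ge0 (x 0 0 * y 0 1 - x 0 1 * y 0 0); nra.
rewrite -(@ler_pXn2r _ 2%N)// ?nnegrE ?addr_ge0 ?enorm_ge0//.
rewrite enorm_sqr sqrrD !enorm_sqr !mxE; nra.
Qed.

Lemma enorm_continuous : continuous (@enorm R).
Proof.
move=> x; apply: continuous_comp; last exact: sqrt_continuous.
have sq i : {for x, continuous (fun y : plane R => y 0 i ^+ 2)}.
  apply: (@continuous_comp _ _ _ (fun y : plane R => y 0 i) (fun a : R => a ^+ 2)).
    exact: coord_continuous.
  exact: exprn_continuous.
exact: (cvgD (sq 0) (sq 1)).
Qed.

Lemma enorm_sub_continuous z : continuous (fun x => enorm (x - z)).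
Proof.
move=> x; apply: (@continuous_comp _ _ _ (fun x => x - z)); last exact: enorm_continuous.
by apply: (@cvgB _ _ _ (nbhs x)); [exact: cvg_id|exact: cvg_cst].
Qed.

Lemma disk_closed (rho : R) q : closed (disk rho q).
Proof.
apply: (@closed_comp _ _ (fun x => enorm (x - q)) [set t | t <= rho]).
  by move=> x _; exact: enorm_sub_continuous.
exact: closed_le.
Qed.

Lemma disk_convex (rho : R) q : @convex_set R (plane R) (disk rho q).
Proof.
apply/convex_setE => x y t; rewrite /disk /= => hx hy /andP[t0 t1].
rewrite (_ : _ - q = (1 - t) *: (x - q) + t *: (y - q)); last first.
  by apply: plane_eq; rewrite !mxE; ring.
apply: (le_trans (enormD _ _)); rewrite !enormZ !ger0_norm ?subr_ge0//.
have := enorm_ge0 (x - q); have := enorm_ge0 (y - q); nra.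
Qed.

End Euclidean.

(** * Goodness, horizons and the greedy count *)

Section GreedyChain.
Context {R : realType}.
Variables (K : set (plane R)) (qs : seq (plane R)) (r eps : R).
Hypotheses (cvxK : @convex_set R (plane R) K) (cptK : compact K).
Variable c : plane R.
Hypothesis ic : interior K c.
Implicit Types (q v w x y z : plane R) (s t u : R).
Local Notation b := (bd K c).
Local Notation E q := (eyelet K r eps q).

Lemma eyelet_convex q : @convex_set R (plane R) (E q).
Proof.
apply/convex_setE => x y t [dx Kx] [dy Ky] t01.
by split; [move/convex_setE: (@disk_convex R (r + eps) q)|move/convex_setE: cvxK]; apply.
Qed.

Lemma eyelet_closed q : closed (E q).
Proof.
apply: closedI; first exact: disk_closed.
by apply: compact_closed => //; exact: norm_hausdorff.
Qed.

Lemma spot_eyelet q v : boundary K v -> spot K r eps q v -> E q v.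
Proof.
move=> bv sp; suff : visible_portion K r eps q v by case.
case: sp => [->//|[w wv ->]]; split=> //.
have vc := boundary_neq_center ic bv.
(* The end [w] is only known to differ from [v] and might be [c], where it has no polar angle; the
   midpoint of [c] and [v] then serves as center. *)
have [e [ie we]] : exists e, interior K e /\ w <> e.
  have [wc|/eqP wc] := eqVneq w c; last by exists c.
  exists ((1 - 2^-1) *: c + 2^-1 *: v); split.
    by apply: interior_comb => //; [exact: boundary_sub|apply/andP; split; lra].
  rewrite wc => H; apply: vc; apply: plane_eq.
  - by move: H => /(congr1 (fun M : plane R => M 0 0)); rewrite !mxE; lra.
  - by move: H => /(congr1 (fun M : plane R => M 0 1)); rewrite !mxE; lra.
have [s vs] := at_angle_exists (boundary_neq_center ie bv).
have [t [st ts wt]] := at_angle_window s we.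
by exists e, s, t, s; split => //; rewrite in_itv /= lexx ltW.
Qed.

Lemma not_goodE (u u' : plane R) : ~ good K qs r eps u u' -> exists q v,
  [/\ q \in qs, spot K r eps q v, arc_oo K u u' v & ~ (seg u u' `&` E q !=set0)].
Proof.
move=> /existsNP[q /existsNP[v /not_implyP[hq /not_implyP[sp /not_implyP[arc h]]]]].
by exists q, v.
Qed.

Lemma eyelet_crossing q s t u z : s < t -> t < u -> u < s + 2 * pi ->
  E q (b t) -> E q z -> arc_hull K c s u z -> seg (b s) (b u) `&` E q !=set0.
Proof.
move=> st tu us Et Ez Hz.
have [y y1 y2] := chord_crossing cvxK cptK ic st tu us Ez.2 Hz.
by exists y; split => //; apply: (seg_sub (@eyelet_convex q) Et Ez).
Qed.

(** Goodness passes from an endpoint to every earlier one: a point where the longer chord meets an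
    eyelet lies beyond the shorter chord, so the eyelet crosses the shorter chord too. Hence the
    horizon cannot lie past a bad [T]. *)
Lemma horizon_bd s T h : s < T -> T <= s + 2 * pi ->
  ~ good K qs r eps (b s) (b T) -> horizon K qs r eps (b s) h ->
  exists t, [/\ s < t, t < T, h = b t &
    forall u, t < u -> u <= s + 2 * pi -> ~ good K qs r eps (b s) (b u)].
Proof.
move=> sT Ts nT [bh gh hmax].
have [t [st ts Eh]] := bd_surj cvxK cptK ic s bh.
exists t; split => //; last first.
  move=> u tu us gu.
  have := hmax _ (bd_boundary cptK ic u) gu; rewrite Eh.
  move=> /(arc_oc_bd cvxK cptK ic st ts)[u' [su' u't]] /(bd_inj cptK ic) Eu.
  have : u = u' by apply: Eu; rewrite ltr_norml; apply/andP; split; lra.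
  lra.
rewrite Eh in gh; have [//|Tt|Et] := ltgtP t T; last by case: nT; rewrite -Et.
have [q [v [hq sp arc nm]]] := not_goodE nT; case: nm.
have bv : boundary K v by case: arc.
have Ev := spot_eyelet bv sp.
have [p [sp1 pT Evp]] := arc_oo_bd cvxK cptK ic sT Ts arc; rewrite Evp in Ev bv sp.
have [z [z1 z2]] : seg (b s) (b t) `&` E q !=set0.
  by apply: gh hq sp _; apply: bd_arc_oo => //; exact: lt_trans Tt.
apply: (eyelet_crossing sp1 pT _ Ev z2); first exact: lt_le_trans ts.
apply: (seg_sub (@arc_hull_convex _ K c s T) _ _ z1).
- by rewrite -(bdD2pi cvxK cptK ic); apply: arc_hull_bd; lra.
- by apply: arc_hull_bd; lra.
Qed.

(** An eyelet that misses [b s] is closed and misses a neighbourhood. So an eyelet with its spot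
    just after [b s] contains [b s], and every chord from there meets it. *)
Lemma good_near s : exists2 t, s < t <= s + 2 * pi & good K qs r eps (b s) (b t).
Proof.
have pi0 := @pi_gt0 R.
have [d d0 hd] : exists2 d, 0 < d & forall q t, q \in qs -> s < t -> t < s + d ->
    E q (b t) -> E q (b s).
  elim: qs => [|q l [d d0 IH]]; first by exists 1.
  have [d' d'0 hd'] : exists2 d', 0 < d' & forall t, s < t -> t < s + d' ->
      E q (b t) -> E q (b s).
    have [h|h] := pselect (E q (b s)); first by exists 1.
    have : nbhs (b s) (~` E q).
      by apply: open_nbhs_nbhs; split=> //; apply: closed_openC; exact: eyelet_closed.
    move=> /(bd_continuous cvxK cptK ic) /nbhs_ballP[e /= e0 he].
    exists e => // t st ts Et; exfalso; apply: (he t) => //.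
    rewrite -ball_normE /= ltr_norml; apply/andP; split; lra.
  exists (Num.min d d'); first by rewrite lt_min d0.
  move=> q' t; rewrite inE => /orP[/eqP -> |hq'] st ts.
  - by apply: hd' => //; apply: (lt_le_trans ts); rewrite lerD2l ge_min lexx orbT.
  - by apply: IH => //; apply: (lt_le_trans ts); rewrite lerD2l ge_min lexx.
pose u := s + Num.min d pi.
have su : s < u by rewrite ltrDl lt_min d0.
have us : u <= s + 2 * pi by rewrite lerD2l ge_min; apply/orP; right; lra.
have ud : u <= s + d by rewrite lerD2l ge_min lexx.
exists u; first by rewrite su.
move=> q v hq sp arc; have bv : boundary K v by case: arc.
have Ev := spot_eyelet bv sp.
have [t [st tu E]] := arc_oo_bd cvxK cptK ic su us arc.
exists (b s); split; first exact: seg_left.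
by apply: (hd q t) => //; [exact: lt_le_trans ud|rewrite -E].
Qed.

(** Each point of the segment avoids [A] for nearby [u]; compactness of the interval of weights
    makes the neighbourhood uniform. *)
Lemma seg_avoid (A : set (plane R)) x t : closed A -> seg x (b t) `&` A = set0 ->
  \forall u \near t, seg x (b u) `&` A = set0.
Proof.
move=> cA tA.
have cpt : compact `[(0:R), 1] by exact: segment_compact.
have h : \forall u \near t, `[(0:R), 1] `<=` fun k => ~ A ((1 - k) *: x + k *: b u).
  apply: ((compact_near_coveringP _).1 cpt _ (nbhs t)
    (fun u k => ~ A ((1 - k) *: x + k *: b u)) _) => k k01.
  have nA : nbhs ((1 - k) *: x + k *: b t) (~` A).
    apply: open_nbhs_nbhs; split; first exact: closed_openC.
    by move=> Ak; suff : set0 ((1 - k) *: x + k *: b t) by []; rewrite -tA; split=> //; exists k.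
  have cf : (1 - z.1) *: x + z.1 *: b z.2 @[z --> (k, t)] --> (1 - k) *: x + k *: b t.
    apply: cvgD; first by apply: cvgZr_tmp; apply: cvgB; [exact: cvg_cst|exact: cvg_fst].
    apply: cvgZ; first exact: cvg_fst.
    by apply: cvg_comp; [exact: cvg_snd|exact: (bd_continuous cvxK cptK ic)].
  exact: cf nA.
near=> u; rewrite -subset0 => y [[k k01 <-]].
by have := near h u; apply.
Unshelve. all: by end_near. Qed.

Lemma horizon_exists s : exists h, horizon K qs r eps (b s) h.
Proof.
pose G := [set t | s < t <= s + 2 * pi /\ good K qs r eps (b s) (b t)].
have [t0 t0s g0] := good_near s.
have Gsup : has_sup G.
  by split; [exists t0|exists (s + 2 * pi) => t [/andP[]]].
(* The supremum is itself good: if its chord missed an eyelet, so would the chords to nearby good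
   endpoints already past the spot. *)
set t := sup G.
have tub u : G u -> u <= t by exact: sup_upper_bound.
have st : s < t.
  by case/andP: (t0s) => h _; apply: (lt_le_trans h); apply: tub.
have ts : t <= s + 2 * pi.
  by apply: ge_sup; [exists t0|move=> u [/andP[]]].
exists (b t); split; first exact: bd_boundary.
- move=> q v hq sp arc.
  have [u [su ut Ev]] := arc_oo_bd cvxK cptK ic st ts arc.
  apply: contrapT => /set0P/negP; rewrite negbK => /eqP.
  move=> /(seg_avoid (@eyelet_closed q)) /nbhs_ballP[e /= e0 he].
  have d0 : 0 < Num.min e (t - u) by rewrite lt_min e0 subr_gt0.
  have [t1 Gt1] := sup_adherent d0 Gsup; rewrite -/t => ht1.
  have m1 : Num.min e (t - u) <= e by rewrite ge_min lexx.
  have m2 : Num.min e (t - u) <= t - u by rewrite ge_min lexx orbT.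
  have t1t := tub _ Gt1.
  have [/andP[_ t1s] g1] := Gt1.
  have [z zE] : seg (b s) (b t1) `&` E q !=set0.
    by apply: g1 hq sp _; rewrite Ev; apply: bd_arc_oo => //; lra.
  suff : set0 z by [].
  rewrite -(he t1)//; rewrite -ball_normE /= ltr_norml; apply/andP; split; lra.
- move=> y by_ gy; have [u [su us Ey]] := bd_surj cvxK cptK ic s by_.
  rewrite Ey; apply: bd_arc_oc => //; apply: tub; split; first by rewrite su.
  by rewrite -Ey.
Qed.

(** * Counting greedy steps against a finite set whose hull meets every eyelet *)

Variable V : seq (plane R).
Hypothesis VK : forall w, w \in V -> K w.
Hypothesis hitV : forall q, q \in qs -> convex_hull [set` V] `&` E q !=set0.

Lemma pocket_vertex s t T : s < t -> t < T -> T <= s + 2 * pi ->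
  (forall u, t < u -> u < T -> ~ good K qs r eps (b s) (b u)) ->
  exists2 w, w \in V & forall u, t < u -> u < T -> ~ arc_hull K c s u w.
Proof.
move=> st tT Ts ng; apply: contrapT => none.
(* If every point of [V] were in some hull, the least of the finitely many parameters would give one
   hull containing all of [V], since [arc_hull] grows as its start moves back. *)
have [U [tU UT hU]] : exists U, [/\ t < U, U < T &
    forall w, w \in V -> arc_hull K c s U w].
  have : forall w, w \in V -> exists u, [/\ t < u, u < T & arc_hull K c s u w].
    move=> w wV; apply: contrapT => h; apply: none; exists w => // u tu uT hu.
    by apply: h; exists u.
  elim: V => [_|w l IH h]; first by exists ((t + T) / 2); split => //; lra.
  have [|U [tU UT hU]] := IH; first by move=> w' w'l; apply: h; rewrite inE w'l orbT.
  have [u [tu uT hu]] := h w (mem_head _ _).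
  exists (Num.min U u); split; first by rewrite lt_min tU.
    by rewrite gt_min UT.
  move=> w'; rewrite inE => /orP[/eqP ->|w'l].
  - by apply: arc_hullS hu; rewrite ge_min lexx orbT.
  - by apply: arc_hullS (hU _ w'l); rewrite ge_min lexx.
have [q [v [hq sp arc nm]]] := not_goodE (ng U tU UT).
have bv : boundary K v by case: arc.
have Ev := spot_eyelet bv sp.
have sU : s < U by lra.
have Us : U <= s + 2 * pi by lra.
have [p [sp1 pU Evp]] := arc_oo_bd cvxK cptK ic sU Us arc.
have [z [z1 z2]] := hitV hq.
apply: nm; apply: (eyelet_crossing sp1 pU _ _ z2); [by lra|by rewrite -Evp|].
by move: z1; apply: convex_hull_min; [exact: arc_hull_convex|exact: hU].
Qed.

(** [greedy_vertices] without the closing condition, so that unfinished runs are covered and the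
    size bound also proves termination. *)
Definition greedy_chain x ps :=
  [/\ (0 < size ps)%N, nth 0 ps 0 = x &
    forall j : nat, (j.+1 < size ps)%N ->
      ~ good K qs r eps (nth 0 ps j) x /\
      horizon K qs r eps (nth 0 ps j) (nth 0 ps j.+1)].

Lemma greedy_chain_size x ps : boundary K x -> greedy_chain x ps ->
  (size ps <= (size V).+1)%N.
Proof.
move=> bx [ps0 p0 step].
have pi0 := @pi_gt0 R.
have [s0 [_ _ xE]] := bd_surj cvxK cptK ic 0 bx.
have bp j : (j < size ps)%N -> boundary K (nth 0 ps j).
  by case: j => [_|j hj]; [rewrite p0|have [_ []] := step j hj].
have angle j : exists t, (j < size ps)%N ->
    [/\ s0 <= t, t < s0 + 2 * pi & nth 0 ps j = b t].
  case: (ltnP j (size ps)) => [hj|]; last by exists 0.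
  have [t [st ts E]] := bd_surj cvxK cptK ic s0 (bp j hj).
  (* A full turn is moved back to [s0], so that [x] has angle [s0] as a vertex, while [s0 + 2 * pi]
     is kept for [x] as the closing point. *)
  have [t2|/eqP t2] := eqVneq t (s0 + 2 * pi).
    exists s0 => _; split => //; first by lra.
    by rewrite E t2 (bdD2pi cvxK cptK ic).
  by exists t => _; split => //; [exact: ltW|rewrite lt_neqAle ts andbT; exact/eqP].
have [ang hang] := choice angle.
have uniqang s t : s0 <= s -> s < s0 + 2 * pi -> s0 <= t -> t < s0 + 2 * pi ->
    b s = b t -> s = t.
  move=> h1 h2 h3 h4 /(bd_inj cptK ic); apply.
  by rewrite ltr_norml; apply/andP; split; lra.
have xE2 : b (s0 + 2 * pi) = x by rewrite (bdD2pi cvxK cptK ic).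
(* Since the chord back to [x] is not good, the next horizon comes strictly before [s0 + 2 * pi],
   and the angles increase without wrapping around. *)
have adv j : (j.+1 < size ps)%N -> ang j < ang j.+1 /\
    forall u, ang j.+1 < u -> u < s0 + 2 * pi ->
      ~ good K qs r eps (b (ang j)) (b u).
  move=> hj; have [a1 a2 a3] := hang _ (ltnW hj); have [b1 b2 b3] := hang _ hj.
  have [ng hor] := step j hj.
  rewrite -xE2 a3 in ng; rewrite a3 in hor.
  have [|t [h1 h2 h3 h4]] := horizon_bd a2 _ ng hor; first by lra.
  have E : ang j.+1 = t by apply: uniqang => //; [lra|rewrite -b3].
  by rewrite E; split=> // u tu us; apply: h4 => //; lra.
have vert j : exists w, (j.+1 < size ps)%N -> w \in V /\
    forall u, ang j.+1 < u -> u < s0 + 2 * pi -> ~ arc_hull K c (ang j) u w.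
  case: (ltnP j.+1 (size ps)) => [hj|]; last by exists 0.
  have [a1 a2 _] := hang _ (ltnW hj); have [b1 b2 _] := hang _ hj.
  have [h1 h2] := adv j hj.
  have [|w wV hw] := pocket_vertex h1 b2 _ h2; first by lra.
  by exists w.
have [w hw] := choice vert.
have mono i j : (i < j)%N -> (j < size ps)%N -> ang i < ang j.
  elim: j => // j IH; rewrite ltnS leq_eqVlt => /orP[/eqP ->|ij] hj.
    by have [] := adv j hj.
  by apply: (lt_trans (IH ij (ltnW hj))); have [] := adv j hj.
have winj i j : (i < j)%N -> (j.+1 < size ps)%N -> w i <> w j.
  move=> ij hj E.
  have hi : (i.+1 < size ps)%N by exact: leq_ltn_trans ij (ltnW hj).
  have [wi hi'] := hw i hi; have [wj hj'] := hw j hj.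
  have [a1 a2 _] := hang _ (ltnW hi); have [b1 b2 _] := hang _ hj.
  apply: (pockets_disjoint cvxK cptK ic (s := ang i) (t := ang i.+1)
    (s' := ang j) (t' := ang j.+1) (T := s0 + 2 * pi) (w := w j)) => //.
  - by have [] := adv i hi.
  - move: ij; rewrite leq_eqVlt => /orP[/eqP -> //|ij].
    by apply/ltW/mono => //; exact: ltnW.
  - by have [] := adv j hj.
  - by lra.
  - exact: VK.
  - by rewrite -E.
(* The map [w] injects the steps into [V]; there is one step fewer than there are vertices in the
   chain, which accounts for the successor. *)
rewrite -(prednK ps0) ltnS -(size_iota 0 (size ps).-1) -(size_map w).
have lt_pred j : (j < (size ps).-1)%N -> (j.+1 < size ps)%N.
  by rewrite -ltnS prednK.
apply: uniq_leq_size; last first.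
  move=> y /mapP[j]; rewrite mem_iota /= add0n => /lt_pred hj ->.
  by have [] := hw j hj.
rewrite map_inj_in_uniq ?iota_uniq// => i j; rewrite !mem_iota /= !add0n.
move=> /lt_pred hi /lt_pred hj E; case: (ltngtP i j) => // ij; exfalso.
- exact: (winj i j).
- exact: (winj j i).
Qed.

Lemma greedy_exists x : boundary K x -> exists ps, greedy_vertices K qs r eps x ps.
Proof.
move=> bx.
have ext ps : greedy_chain x ps -> ~ good K qs r eps (nth 0 ps (size ps).-1) x ->
    exists h, greedy_chain x (rcons ps h).
  move=> [ps0 p0 step] ng.
  have bl : boundary K (nth 0 ps (size ps).-1).
    move: step ps0; case: (size ps).-1 (ltn_predL (size ps)) => [|j] hj step ps0.
      by rewrite p0.
    by have [_ []] := step j ltac:(by rewrite ps0 in hj).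
  have [s [_ _ sE]] := bd_surj cvxK cptK ic 0 bl.
  have [h hh] := horizon_exists s; rewrite -sE in hh; exists h.
  split; rewrite ?size_rcons// ?nth_rcons ?ps0// => j.
  rewrite ltnS leq_eqVlt => /orP[/eqP jE|hj]; last first.
    by rewrite !nth_rcons hj (ltnW hj); exact: step.
  rewrite !nth_rcons -jE ltnSn ltnn eqxx.
  by rewrite -jE in ng hh.
(* [n] bounds the number of extensions left before the chain would exceed [greedy_chain_size]. *)
have end_or n : forall ps, greedy_chain x ps -> ((size V).+1 <= size ps + n)%N ->
    exists ps', greedy_vertices K qs r eps x ps'.
  elim: n => [|n IH] ps ch hn;
      have [g|ng] := pselect (good K qs r eps (nth 0 ps (size ps).-1) x);
      try by (exists ps; case: ch).
  - have [h /(greedy_chain_size bx)] := ext ps ch ng.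
    by rewrite size_rcons => h'; move: (leq_trans h' hn); rewrite addn0 ltnn.
  - by have [h ch'] := ext ps ch ng; apply: (IH _ ch'); rewrite size_rcons addSnnS.
by apply: (end_or (size V) [:: x]) => //=; rewrite add1n.
Qed.

End GreedyChain.

(** * Insets, offsets and polygonal regions *)

Section Compactness.
Context {R : realType}.
Implicit Types (q x y z : plane R) (X Y A : set (plane R)) (rho : R).

(** The join of [q] and [A], written as the image of a product so that compactness is inherited. *)
Definition cone q A : set (plane R) :=
  [set (1 - z.1) *: q + z.1 *: z.2 | z in `[0, 1] `*` A].

Lemma cone_compact q A : compact A -> compact (cone q A).
Proof.
move=> cA; apply: continuous_compact; last first.
  by apply: compact_setX => //; exact: segment_compact.
apply: continuous_subspaceT => z; apply: cvgD.
- by apply: cvgZr_tmp; apply: cvgB; [exact: cvg_cst|exact: cvg_fst].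
- by apply: cvgZ; [exact: cvg_fst|exact: cvg_snd].
Qed.

Lemma cone_convex q A :
  @convex_set R (plane R) A -> @convex_set R (plane R) (cone q A).
Proof.
move=> /convex_setE cA; apply/convex_setE => x y u.
move=> [[s a] [/= /[!in_itv] /= /andP[s0 s1] Aa] <-].
move=> [[t b] [/= /[!in_itv] /= /andP[t0 t1] Ab] <-] /andP[u0 u1].
pose k := (1 - u) * s + u * t.
have k0 : 0 <= k by rewrite addr_ge0// mulr_ge0// subr_ge0.
have [kE|kn] := eqVneq k 0.
  exists (0, a); first by split => //=; rewrite in_itv /= lexx ler01.
  have h1 : (1 - u) * s = 0.
    apply/eqP; rewrite eq_le mulr_ge0 ?subr_ge0// andbT -kE /k lerDl.
    exact: mulr_ge0.
  have h2 : u * t = 0 by rewrite -kE /k h1 add0r.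
  apply: plane_eq; rewrite !mxE /= subr0 mul0r addr0 mul1r.
  - transitivity (((1 - u) + u) * q 0 0 - ((1 - u) * s) * (q 0 0 - a 0 0)
      - (u * t) * (q 0 0 - b 0 0)); last by ring.
    by rewrite h1 h2; ring.
  - transitivity (((1 - u) + u) * q 0 1 - ((1 - u) * s) * (q 0 1 - a 0 1)
      - (u * t) * (q 0 1 - b 0 1)); last by ring.
    by rewrite h1 h2; ring.
have kp : 0 < k by rewrite lt_neqAle eq_sym kn.
have ut0 : 0 <= u * t by exact: mulr_ge0.
have us0 : 0 <= (1 - u) * s by rewrite mulr_ge0// subr_ge0.
exists (k, (1 - u * t / k) *: a + (u * t / k) *: b).
  split => /=; first by rewrite in_itv /= k0 /k; nra.
  apply: cA => //; rewrite divr_ge0//= ler_pdivrMr// mul1r /k; lra.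
by apply: plane_eq; rewrite !mxE /= /k; field; exact: kn.
Qed.

(** By induction on the list: adding a point to a nonempty list turns the hull into the cone over
    the previous hull. *)
Lemma compact_convex_hull (qs : seq (plane R)) :
  compact (convex_hull [set` qs]).
Proof.
case: qs => [|q l].
  rewrite (_ : convex_hull _ = set0); first exact: compact0.
  by rewrite -subset0; apply: convex_hull_min => // x y k; rewrite inE.
elim: l q => [|p l IH] q.
  rewrite (_ : convex_hull _ = [set q]); first exact: compact_set1.
  apply/seteqP; split; last first.
    by move=> _ ->; apply: convex_hull_sub; rewrite /= mem_head.
  apply: convex_hull_min; last by move=> x /=; rewrite inE => /eqP.
  apply/convex_setE => x y t -> -> _ /=.
  by rewrite -scalerDl subrK scale1r.
rewrite (_ : convex_hull _ = cone q (convex_hull [set` p :: l])).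
  by apply: cone_compact; exact: IH.
apply/seteqP; split.
- apply: convex_hull_min; first by apply: cone_convex; exact: convex_hull_convex.
  move=> x /=; rewrite inE => /orP[/eqP ->|hx].
  + exists (0, p) => /=; last by rewrite subr0 scale1r scale0r addr0.
    split; first by rewrite /= in_itv /= lexx ler01.
    by apply: convex_hull_sub; rewrite /= mem_head.
  + exists (1, x) => /=; last by rewrite subrr scale1r scale0r add0r.
    split; first by rewrite /= in_itv /= lexx ler01.
    by apply: convex_hull_sub.
- move=> _ [[t y] [/= t01 hy] <-].
  have /convex_setE := @convex_hull_convex R [set` q :: p :: l]; apply => //.
  + by apply: convex_hull_sub; rewrite /= mem_head.
  + move: y hy; apply: convex_hull_min; first exact: convex_hull_convex.
    by move=> y /= hy; apply: convex_hull_sub; rewrite /= inE hy orbT.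
Qed.

Lemma norm_le_enorm x : `|x| <= enorm x.
Proof.
rewrite [leLHS]/Num.norm /= mx_normrE; apply/bigmax_leP; split; first exact: enorm_ge0.
move=> [i j] _ /=; rewrite (ord1 i).
rewrite -(@ler_pXn2r _ 2%N) ?nnegrE ?enorm_ge0// enorm_sqr real_normK ?num_real//.
have [->|->] : j = 0 \/ j = 1.
  by case: j => -[|[|//]] hj; [left|right]; exact/val_inj.
- by rewrite lerDl sqr_ge0.
- by rewrite lerDr sqr_ge0.
Qed.

Lemma disk_compact rho : compact (disk rho (0 : plane R)).
Proof.
apply: bounded_closed_compact; last exact: disk_closed.
exists rho; split; first exact: num_real.
move=> M hM x; rewrite /disk /= subr0 => hx.
by apply: (le_trans (norm_le_enorm x)); apply: (le_trans hx); exact: ltW.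
Qed.

Lemma offset_compact X rho : compact X -> compact (offset X rho).
Proof.
move=> cX; rewrite (_ : offset X rho = (fun z : plane R * plane R => z.1 + z.2) @` (X `*` disk rho 0)).
  apply: continuous_compact; last by apply: compact_setX => //; exact: disk_compact.
  by apply: continuous_subspaceT => z; apply: cvgD; [exact: cvg_fst|exact: cvg_snd].
apply/seteqP; split => [_ [x hx [d hd <-]]|_ [[x d] [/= hx hd] <-]].
- by exists (x, d).
- by exists x => //; exists d.
Qed.

Lemma offset_convex X rho : @convex_set R (plane R) X ->
  @convex_set R (plane R) (offset X rho).
Proof.
move=> /convex_setE cX; apply/convex_setE => x' y' t.
move=> [x hx [d hd <-]] [y hy [e he <-]] t01.
exists ((1 - t) *: x + t *: y); first exact: cX.
exists ((1 - t) *: d + t *: e); last by rewrite !scalerDr addrACA.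
by have /convex_setE := @disk_convex R rho 0; apply.
Qed.

Lemma inset_convex X rho : @convex_set R (plane R) X ->
  @convex_set R (plane R) (inset X rho).
Proof.
move=> /convex_setE cX; apply/convex_setE => x y t hx hy t01 z hz.
set m := _ + _ in hz.
rewrite (_ : z = (1 - t) *: (x + (z - m)) + t *: (y + (z - m))).
  by apply: cX => //; [apply: hx|apply: hy]; rewrite /disk /= [_ + (z - m)]addrC addrK.
by rewrite /m; apply: plane_eq; rewrite !mxE; ring.
Qed.

(** The inset is an intersection of translates of a closed set, and it lies in [X] because each disk
    contains its own center. *)
Lemma inset_compact X rho : 0 <= rho -> compact X -> compact (inset X rho).
Proof.
move=> r0 cX; have clX : closed X by apply: compact_closed => //; exact: norm_hausdorff.
apply: (@subclosed_compact _ _ X) => //; last first.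
  by move=> x; apply; rewrite /disk /= subrr -(scale0r 0) enormZ normr0 mul0r.
rewrite (_ : inset X rho = \bigcap_(d in disk rho 0) [set x | X (x + d)]).
  apply: closed_bigI => d _.
  apply: (@closed_comp _ _ (fun x => x + d) X) => // x _.
  by apply: (@cvgD _ _ _ (nbhs x)); [exact: cvg_id|exact: cvg_cst].
apply/seteqP; split => x hx => [d hd|y hy].
- by apply: hx; move: hd; rewrite /disk /= subr0 addrC addKr.
- by rewrite -(subrK x y) addrC; apply: hx; rewrite /disk /= subr0.
Qed.

(** * Hausdorff closeness and polygonal regions *)

Lemma dist_to_le (e : R) x Y : compact Y -> (dist_to x Y <= e%:E)%E ->
  exists2 y, Y y & enorm (x - y) <= e.
Proof.
move=> cY hxY.
have [Y0|/set0P nY] := eqVneq Y set0.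
  by move: hxY; rewrite /dist_to Y0 image_set0 ereal_inf0 leye_eq.
have cf : {within Y, continuous (fun y => enorm (x - y))}.
  apply: continuous_subspaceT => y.
  by under eq_fun do rewrite enormC; exact: enorm_sub_continuous.
have [y yY ymin] := EVT_min_rV nY cY cf.
exists y; first by rewrite inE in yY.
rewrite -lee_fin; apply: le_trans hxY; apply: le_ereal_inf_tmp => _ [z zY <-].
by rewrite lee_fin; apply: ymin; rewrite inE.
Qed.

Lemma eps_close_dist (e : R) X Y : eps_close e X Y ->
  (forall x, X x -> (dist_to x Y <= e%:E)%E) /\
  (forall y, Y y -> (dist_to y X <= e%:E)%E).
Proof.
rewrite /eps_close /hausdorff ge_max => /andP[h1 h2]; split.
- by move=> x hx; apply: le_trans h1; apply: ereal_sup_ubound; exists x.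
- by move=> y hy; apply: le_trans h2; apply: ereal_sup_ubound; exists y.
Qed.

(** One half of the Hausdorff bound: every point of the [r]-disk about a point of [X] is within [e]
    of [Y]. *)
Lemma close_region_sub (r e : R) X Y : compact Y ->
  eps_close e (offset X r) Y -> X `<=` inset (offset Y e) r.
Proof.
move=> cY /eps_close_dist[h _] x Xx z hz.
have [|y Yy hy] := dist_to_le cY (h z _).
  exists x => //; exists (z - x); last by rewrite addrC subrK.
  by rewrite /disk /= subr0.
exists y => //; exists (z - y); last by rewrite addrC subrK.
by rewrite /disk /= subr0.
Qed.

(** The other half of the Hausdorff bound, followed by the triangle inequality through a point of
    the offset. *)
Lemma close_region_meets (r e : R) X Y y : compact X ->
  eps_close e (offset X r) Y -> Y y -> X `&` disk (r + e) y !=set0.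
Proof.
move=> cX /eps_close_dist[_ h] Yy.
have [_ [x Xx [d hd <-]] hy] := dist_to_le (offset_compact (rho := r) cX) (h y Yy).
exists x; split => //; move: hd; rewrite /disk /= subr0 => hd.
rewrite enormC (_ : y - x = d + (y - (x + d))); last by apply: plane_eq; rewrite !mxE; ring.
exact: le_trans (enormD _ _) (lerD hd hy).
Qed.

Lemma vertices_sub (P : polygonal_region R) w : w \in vertices P -> region P w.
Proof.
rewrite mem_undup mem_cat => hw.
suff : boundary P w by case; rewrite -(closure_id P).1//; exact: region_closed.
rewrite region_boundary; case/orP: hw => /mapP[e he ->]; exists e => //.
- exact: seg_left.
- exact: seg_right.
Qed.

(* A chord through an interior point ends at two boundary points. *)
Lemma region_sub_hull (P : polygonal_region R) : compact P ->
  P `<=` convex_hull [set` vertices P].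
Proof.
move=> cP.
have bnd x : boundary P x -> convex_hull [set` vertices P] x.
  rewrite region_boundary => -[e he]; apply: seg_sub.
  - exact: convex_hull_convex.
  - by apply: convex_hull_sub; rewrite /= mem_undup mem_cat map_f.
  - by apply: convex_hull_sub; rewrite /= mem_undup mem_cat map_f ?orbT.
move=> x Px; have [ix|nx] := pselect (interior P x); last first.
  by apply: bnd; exact: boundaryP.
apply: (seg_sub _ _ _ (center_in_seg cP 0 ix)); first exact: convex_hull_convex.
- by apply: bnd; exact: bd_boundary.
- by apply: bnd; exact: bd_boundary.
Qed.

End Compactness.

Theorem theorem29 (R : realType) (Q : set (plane R)) (qs : seq (plane R))
    (r eps : R) (P : polygonal_region R) (s : plane R) :
  convex_polygon Q qs ->
  0 < eps -> eps < r ->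
  let Pi := inset (offset Q eps) r in
  eps_close eps (offset Pi r) Q ->
  minimal_region Q r eps P ->
  boundary Pi s ->
  (exists ps, greedy_vertices Pi qs r eps s ps) /\
  (forall ps, greedy_vertices Pi qs r eps s ps ->
     (size ps <= (size (vertices P)).+1)%N).
Proof.
move=> [_ _ QE] eps0 epsr Pi _ [closeP _] bs.
have cptQ : compact Q by rewrite QE; exact: compact_convex_hull.
have cvxPi : @convex_set R (plane R) Pi.
  by apply/inset_convex/offset_convex; rewrite QE; exact: convex_hull_convex.
have r0 : 0 <= r by lra.
have cptPi : compact Pi by apply/inset_compact => //; exact: offset_compact.
have PPi : P `<=` Pi by exact: close_region_sub.
have cptP : compact P by apply: subclosed_compact cptPi PPi; exact: region_closed.
have VPi w : w \in vertices P -> Pi w by move=> /vertices_sub; exact: PPi.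
(* Closeness brings a point of [P] within [r + eps] of [q]; it lies in [Pi], hence in the eyelet,
   and in the hull of the vertices. *)
have hitV q : q \in qs ->
    convex_hull [set` vertices P] `&` eyelet Pi r eps q !=set0.
  move=> hq; have Qq : Q q by rewrite QE; exact: convex_hull_sub.
  have [x [Px hx]] := close_region_meets cptP closeP Qq.
  by exists x; split; [exact: region_sub_hull|split => //; exact: PPi].
have [[c ic]|nc] := pselect (interior Pi !=set0).
  split; first exact: (greedy_exists cvxPi cptPi ic VPi hitV bs).
  move=> ps [h1 h2 h3 _].
  exact: (greedy_chain_size cvxPi cptPi ic VPi hitV bs).
(* Without interior points there are no journeys, so all arcs are empty, every segment is good and
   the run stops at its first vertex. *)
have gd u u' : good Pi qs r eps u u'.
  by move=> q v _ _ [_ [c [a [b [t [[ic _ _ _ _] _ _]]]]]]; case: nc; exists c.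
split; first by exists [:: s]; split => //= j.
move=> ps [h1 h2 h3 _]; case: (ltnP 1 (size ps)) => [h|h].
  by have [] := h3 0%N h.
exact: leq_trans h _.
Qed.
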